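(* Let $T>0$, $\gamma>\frac12$, $0\le\rho\le\gamma$ and $0<\varsigma<\gamma-\rho$, and assume $\varsigma+\gamma>1$. Let $E$ be a Banach space. Suppose that $X:[0,T]\times E\to E$ satisfies, for any $x,y\in E$ and $s\le t\in[0,T]$, with $X_{s,t}:=X_t-X_s$, $$\text{(i)}\quad|X_{s,t}(x)|_E\lesssim H(|x|_E)|t-s|^\gamma,\qquad\text{(ii)}\quad|X_{s,t}(x)-X_{s,t}(y)|_E\lesssim H(|x|_E\vee|y|_E)\,|x-y|_E\,|t-s|^\gamma,$$ where $H$ is a positive locally bounded function on $\mathbb{R}_+$. Let $(S_t)_{t\in[0,T]}$ be a $\rho$-singular linear operator on $E$ (see context). For $y\in\mathscr{C}^\varsigma_TE$ define the non-linear Young–Volterra integral by $$\Theta(y)_t:=\lim_{|\mathcal{P}|\to0}\sum_{[u,v]\in\mathcal{P}}S_{t-u}X_{u,v}(y_u),$$ the limit being over partitions $\mathcal{P}$ of $[0,t]$ with mesh $|\mathcal{P}|\to0$. Then this limit exists in $E$, the integration map $\Theta$ is a continuous non-linear operator from $\mathscr{C}^\varsigma_TE$ to $\mathscr{C}^\varsigma_TE$, and for all $y\in\mathscr{C}^\varsigma_TE$ and $s\le t\in[0,T]$ $$|\Theta(y)_t-\Theta(y)_s|_E\lesssim\sup_{0\le z\le\|y\|_\infty}H(z)\,(1+[y]_\varsigma)\,(t-s)^\varsigma\,T^{\gamma-\rho+\varsigma},$$ where the implicit constant does not depend on $y,s,t$. Furthermore, for any bounded linear operator $A\in\mathcal{L}(E)$,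 $$A\,\Theta(y)_t=\lim_{|\mathcal{P}|\to0}\sum_{[u,v]\in\mathcal{P}}A\,S_{t-u}X_{u,v}(y_u).$$
   Context: $f\lesssim g$ means $f\le Cg$ for some constant $C>0$. $\|y\|_\infty=\sup_{t\in[0,T]}|y_t|_E$. Singular Hölder space: for $\varsigma\in(0,1)$, $\mathscr{C}^\varsigma_TE$ is the space of $y:[0,T]\to E$ with $[y]_\varsigma:=\sup_{s\le t\in[0,T],\ \zeta\in[0,\varsigma]}\frac{|y_t-y_s|_E}{|t-s|^\zeta s^{-\zeta}}<\infty$, with norm $|y_0|_E+[y]_\varsigma$. $\rho$-singular operator: a family $(S_t)_{t\in[0,T]}$ of linear operators in $\mathcal{L}(E)$ such that for any $\theta,\theta'\in[0,1]$, any $0\le s\le t\le\tau'\le\tau\le T$ and $u\in E$ (whenever the right-hand sides are finite): (i) $|S_tu|_E\lesssim t^{-\rho}|u|_E$; (ii) $|(S_t-S_s)u|_E\lesssim(t-s)^\theta s^{-\theta-\rho}|u|_E$; (iii) $\big|\big((S_{\tau-t}-S_{\tau-s})-(S_{\tau'-t}-S_{\tau'-s})\big)u\big|_E\lesssim(\tau-\tau')^{\theta'}(t-s)^\theta(\tau'-t)^{-\theta-\theta'-\rho}|u|_E$. *)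

(* Defs.v *)
(* MathComp-Analysis.

   A map [0, T] -> E is represented by a function R -> E of which only the
   values on [0, T] matter; two such functions are the same element of a space
   of paths when they agree on [0, T]. *)
From HB Require Import structures.
From mathcomp Require Import all_boot all_order all_algebra.
From mathcomp Require Import all_classical all_reals all_analysis.
Set Implicit Arguments.
Unset Strict Implicit.
Unset Printing Implicit Defensive.
Import Order.TTheory GRing.Theory Num.Theory.
Import numFieldNormedType.Exports.
Local Open Scope classical_set_scope.
Local Open Scope ring_scope.

Section paths.
Context {R : realType} {E : completeNormedModType R}.
Implicit Types (T sigma : R) (y : R -> E).

Definition path_sup_norm T y : \bar R :=
  ereal_sup [set `|y t|%:E | t in `[0, T]].

(* The quotient is |y_t - y_s| / (|t - s|^zeta s^(-zeta)). At s = 0 < zeta the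
   denominator is infinite and the quotient is 0 (as 0 `^ zeta = 0); at
   s = zeta = 0 it is |y_t - y_0| (as 0 `^ 0 = 1); at s = t it is 0. *)
Definition singular_holder_seminorm T sigma y : \bar R :=
  ereal_sup [set r | exists s t zeta : R,
    [/\ 0 <= s <= t, t <= T, 0 <= zeta <= sigma &
        r = (`|y t - y s| * s `^ zeta / (t - s) `^ zeta)%:E]].

Definition singular_holder T sigma y : Prop :=
  (singular_holder_seminorm T sigma y < +oo)%E.

Definition singular_holder_norm T sigma y : \bar R :=
  (`|y 0|%:E + singular_holder_seminorm T sigma y)%E.

(* Continuity of F from the singular Hoelder space to itself, for the distance
   induced by the norm; F is nowhere assumed to be linear. *)
Definition singular_holder_continuous T sigma
    (F : (R -> E) -> (R -> E)) : Prop :=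
  forall y, singular_holder T sigma y ->
  forall eps : R, 0 < eps -> exists2 delta : R, 0 < delta &
  forall y', singular_holder T sigma y' ->
    (singular_holder_norm T sigma (y' \- y)%R < delta%:E)%E ->
    (singular_holder_norm T sigma (F y' \- F y)%R < eps%:E)%E.

End paths.

(* For x, a >= 0: the quantity x^(-a) is finite. In that case x `^ (- a) is its
   value; when x = 0 < a, x `^ (- a) is 0 whereas x^(-a) is +oo. *)
Definition finite_npow {R : realType} (x a : R) : bool := (x != 0) || (a == 0).

(* The implicit constants may depend on the exponents theta and theta'. *)
Definition singular_operator {R : realType} {E : completeNormedModType R}
    (T rho : R) (S : R -> {linear E -> E}) : Prop :=
  [/\ forall t, 0 <= t <= T -> continuous (S t),
      exists2 C : R, 0 < C & forall (t : R) (u : E), 0 <= t <= T ->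
        finite_npow t rho ->
        `|S t u| <= C * t `^ (- rho) * `|u|,
      forall theta : R, 0 <= theta <= 1 ->
      exists2 C : R, 0 < C & forall (s t : R) (u : E), 0 <= s <= t -> t <= T ->
        finite_npow s (theta + rho) ->
        `|S t u - S s u|
          <= C * (t - s) `^ theta * s `^ (- (theta + rho)) * `|u|
    & forall theta theta' : R, 0 <= theta <= 1 -> 0 <= theta' <= 1 ->
      exists2 C : R, 0 < C & forall (s t tau' tau : R) (u : E),
        0 <= s <= t -> t <= tau' <= tau -> tau <= T ->
        finite_npow (tau' - t) (theta + theta' + rho) ->
        `|(S (tau - t) u - S (tau - s) u) - (S (tau' - t) u - S (tau' - s) u)|
          <= C * (tau - tau') `^ theta' * (t - s) `^ theta
               * (tau' - t) `^ (- (theta + theta' + rho)) * `|u| ].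

Section young_volterra.
Context {R : realType}.

(* As for itv_partition, a partition a = p_0 < p_1 < ... < p_n = b is
   represented by the sequence p = [:: p_1; ...; p_n] without the left endpoint
   a. *)
Definition partition_intervals (a : R) (p : seq R) : seq (R * R) :=
  zip (a :: p) p.

Definition mesh (a : R) (p : seq R) : R :=
  \big[Num.max/0]_(I <- partition_intervals a p) (I.2 - I.1).

(* The filter of partitions of [a, b] with mesh tending to 0. *)
Definition mesh_to0 (a b : R) : set_system (seq R) :=
  filter_from [set eps : R | 0 < eps]
    (fun eps => [set p | itv_partition a b p /\ mesh a p < eps]).

Global Instance mesh_to0_filter (a b : R) : Filter (mesh_to0 a b).
Proof.
apply: filter_from_filter; first by exists 1; rewrite /= ltr01.
move=> i j /= i0 j0; exists (Num.min i j); first by rewrite /= lt_min i0.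
by move=> p /= [pp]; rewrite lt_min => /andP[pi pj]; split.
Qed.

Context {E : completeNormedModType R}.

Definition volterra_sum (S : R -> E -> E) (X : R -> E -> E) (y : R -> E)
    (t : R) (p : seq R) : E :=
  \sum_(I <- partition_intervals 0 p)
    S (t - I.1) (X I.2 (y I.1) - X I.1 (y I.1)).

Definition young_volterra (S : R -> E -> E) (X : R -> E -> E) (y : R -> E)
    (t : R) : E :=
  lim (volterra_sum S X y t p @[p --> mesh_to0 0 t]).

End young_volterra.

(* Main.v *)
Require Import Defs.
From HB Require Import structures.
From mathcomp Require Import all_boot all_order all_algebra.
From mathcomp Require Import all_classical all_reals all_analysis.
From mathcomp Require Import ring lra.
Set Implicit Arguments.
Unset Strict Implicit.
Unset Printing Implicit Defensive.
Import Order.TTheory GRing.Theory Num.Theory.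
Import numFieldNormedType.Exports.
Local Open Scope classical_set_scope.
Local Open Scope ring_scope.

(* For t in [0, T] the germ A_(u, v) = S_(t - u) X_(u, v)(y_u) has defect
     A_(u, v) - A_(u, m) - A_(m, v) = (S_(t - u) - S_(t - m)) X_(m, v)(y_u)
       + S_(t - m) (X_(m, v)(y_u) - X_(m, v)(y_m)),
   which is at most a constant times
     (v - m)^g (t - m)^(-r) [((m - u) / (t - u))^th + ((m - u) / m)^th]
   with r = rho and th = sigma. Although singular at 0 and at t, this is at most
   a constant times w(u, v)^(th + g), where w(u, v) = phi(v) - phi(u) is the
   additive control given by phi(x) = x^al - (t - x)^al with
   al = (g - r) / (th + g) < 1. As th + g > 1, the sewing argument applies on
   all partitions at once. The same estimate with r = rho + sigma handles
   (S_(t - u) - S_(s - u)) X_(u, v)(y_u) on [0, s] and gives the Hoelder bound.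
   Since X is only assumed Lipschitz in space, continuity of the integral comes
   from interpolation: the defect for the difference of two paths is small in
   sup norm, at the price of a slightly smaller exponent th < sigma. *)

(** * Partitions and sewing *)

Section partitions.
Context {R : realType}.
Implicit Types (a b c d : R) (p q : seq R).

Lemma mesh_cons a x p : mesh a (x :: p) = Num.max (x - a) (mesh x p).
Proof. by rewrite /mesh /partition_intervals /= big_cons. Qed.

Lemma mesh_cat a p q :
  mesh a (p ++ q) = Num.max (mesh a p) (mesh (last a p) q).
Proof.
elim: p a => [|x p ih] a /=; last by rewrite !mesh_cons ih maxA.
rewrite {2}/mesh /partition_intervals /= big_nil max_r //.
by rewrite /mesh big_seq; elim/big_rec: _ => // *;
  rewrite le_max; apply/orP; right.
Qed.

(** The shape [rcons p x ++ q] is the one that [path.splitP] and [split_find] produce when a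
    partition is cut at one of its points. *)
Lemma itv_partition_split a b x p q : itv_partition a b (rcons p x ++ q) ->
  itv_partition a x (rcons p x) /\ itv_partition x b q.
Proof.
rewrite /itv_partition cat_path last_cat !last_rcons.
by move=> [/andP[-> ->] ->].
Qed.

Lemma itv_partition_rcons a x p : itv_partition a x (rcons p x) ->
  itv_partition a (last a p) p /\ last a p < x.
Proof. by rewrite /itv_partition rcons_path => -[/andP[-> ->] _]. Qed.

Lemma itv_partition_small_mesh a b (e : R) : a <= b -> 0 < e ->
  exists p, itv_partition a b p /\ mesh a p < e.
Proof.
(* Steps of length [h] are taken until at most [h] remains; the induction is on a bound for their
   number. *)
move=> ab e0; pose h := e / 2.
have h0 : 0 < h by rewrite divr_gt0.
have he : h < e by rewrite /h; lra.
have [n] : exists n : nat, b - a <= n%:R * h.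
  exists (Num.bound ((b - a) / h)); rewrite -ler_pdivrMr//.
  by rewrite ltW // archi_boundP // divr_ge0 ?(ltW h0) // subr_ge0.
elim: n a ab => [|n ih] a ab ban.
  have -> : a = b by apply/le_anti; rewrite ab -subr_le0; lra.
  exists [::]; split; first by split.
  by rewrite /mesh big_nil.
have [bah|bah] := leP (b - a) h.
  move: ab; rewrite le_eqVlt => /predU1P[<-|ab].
    by exists [::]; split; [by split|rewrite /mesh big_nil].
  exists [:: b]; split; first exact: itv_partition1.
  rewrite mesh_cons /mesh big_nil gt_max e0 andbT; lra.
have [||p [[pp pl] mp]] := ih (a + h); first by lra.
  by move: ban; rewrite -natr1 mulrDl mul1r; lra.
exists (a + h :: p); split; first by split => //=; rewrite pp andbT; lra.
by rewrite mesh_cons gt_max mp andbT; lra.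
Qed.

(** Properness makes limits along partitions unique and lets completeness of [E] turn Cauchy sums
    into convergent ones. *)
Lemma mesh_to0_proper a b : a <= b -> ProperFilter (mesh_to0 a b).
Proof.
move=> ab; apply: filter_from_proper => e /= e0.
exact: itv_partition_small_mesh.
Qed.

Lemma itv_partition_refine a b p q :
  itv_partition a b p -> itv_partition a b q ->
  exists r, [/\ itv_partition a b r, {subset p <= r} & {subset q <= r}].
Proof.
move=> hp hq; exists (sort <=%R (undup (p ++ q))); split; last 2 first.
- by move=> x xp; rewrite mem_sort mem_undup mem_cat xp.
- by move=> x xq; rewrite mem_sort mem_undup mem_cat xq orbT.
set r := sort _ _.
have ge_a s : itv_partition a b s -> {in s, forall x, a < x <= b}.
  move=> hs x xs; case/path.splitP: xs hs => s1 s2 /itv_partition_split[h1 h2].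
  rewrite (itv_partition_le h2) andbT.
  by apply: itv_partition_size_neq0 h1; rewrite size_rcons.
have r_ab : {in r, forall x, a < x <= b}.
  by move=> x; rewrite mem_sort mem_undup mem_cat => /orP[]; exact: ge_a.
have sr : sorted <%R r.
  by rewrite lt_sorted_uniq_le sort_uniq undup_uniq sort_le_sorted.
have pr : path <%R a r.
  case: r sr r_ab => //= x r sr /(_ x); rewrite inE eqxx => /(_ isT)/andP[-> _].
  by rewrite sr.
split => //.
(* It remains to see that [r] ends at [b]. An empty [p] forces a = b, hence an empty [q]; otherwise
   [b] occurs in [r], and a point after it would exceed [b]. *)
have [p0|pn0] := eqVneq p [::].
  move: hp; rewrite p0 => /itv_partition_nil ab.
  by move: hq; rewrite ab => /itv_partitionxx q0; rewrite /r p0 q0.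
have br : b \in r.
  rewrite mem_sort mem_undup mem_cat; apply/orP; left.
  by case: (p) pn0 hp => // x s _ [_ /eqP <-]; rewrite /= mem_last.
case/path.splitP: br pr r_ab => r1 r2; rewrite cat_path last_cat last_rcons.
case: r2 => //= x r2 /and3P[_ bx _] /(_ x).
by rewrite mem_cat inE eqxx orbT => /(_ isT) /andP[_]; rewrite leNgt bx.
Qed.

End partitions.

Section sewing.
Context {R : realType} {E : completeNormedModType R}.
Implicit Types (a b : R) (p q : seq R) (A : R -> R -> E).

Definition partition_sum A a p : E :=
  \sum_(I <- partition_intervals a p) A I.1 I.2.

Lemma partition_sum_nil A a : partition_sum A a [::] = 0.
Proof. by rewrite /partition_sum big_nil. Qed.

Lemma partition_sum_cons A a x p :
  partition_sum A a (x :: p) = A a x + partition_sum A x p.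
Proof. by rewrite /partition_sum /partition_intervals /= big_cons. Qed.

Lemma partition_sum_cat A a p q : partition_sum A a (p ++ q) =
  partition_sum A a p + partition_sum A (last a p) q.
Proof.
elim: p a => [|x p ih] a /=; first by rewrite partition_sum_nil add0r.
by rewrite !partition_sum_cons ih addrA.
Qed.

Lemma partition_sumB A B a p : partition_sum (fun u v => A u v - B u v) a p =
  partition_sum A a p - partition_sum B a p.
Proof. by rewrite /partition_sum sumrB. Qed.

(** This is the sum of the geometric series 2 * 2^((1 - k) n), that is, the solution of C = 2 + 2 C
    2^(-k), the recursion met in the sewing induction. *)
Definition sewing_const (k : R) : R := 2 / (1 - 2 `^ (1 - k)).

Lemma sewing_const_gt0 (k : R) : 1 < k -> 0 < sewing_const k.
Proof.
move=> k1; rewrite divr_gt0 // subr_gt0 powRB ?powRr1 //;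
  last by apply/implyP; rewrite pnatr_eq0.
rewrite ltr_pdivrMr ?powR_gt0 // mul1r -[ltLHS]powRr1 //.
by rewrite /powR pnatr_eq0 /= ltr_expR ltr_pM2r // ln_gt0 // ltr1n.
Qed.

Lemma sewing_constE (k : R) : 1 < k ->
  2 + 2 * (sewing_const k * (1 / 2) `^ k) = sewing_const k.
Proof.
move=> k1; have := sewing_const_gt0 k1; rewrite /sewing_const.
rewrite pmulr_rgt0 // invr_gt0 => h.
have -> : (1 / 2) `^ k = 2 `^ (1 - k) / 2 :> R.
  rewrite div1r -[X in X `^ k]powR_inv1 // -powRrM mulN1r powRD;
    last by apply/implyP; rewrite pnatr_eq0.
  by rewrite powRr1 // mulrAC divff ?pnatr_eq0 ?mul1r.
by field; rewrite gt_eqF.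
Qed.

Section bound.
Context (lo hi : R) (A : R -> R -> E) (phi : R -> R) (k M : R).
Hypotheses (k1 : 1 < k) (M0 : 0 <= M).
Hypothesis phi_mono :
  forall u v, lo <= u -> u <= v -> v <= hi -> phi u <= phi v.
Hypothesis A_diag : forall u, A u u = 0.
Hypothesis A_delta : forall u m v, lo <= u -> u < m -> m < v -> v <= hi ->
  `|A u v - A u m - A m v| <= M * (phi v - phi u) `^ k.

(* The partition is cut at the subinterval where the control reaches half of
   its total mass, so that the control is at most halved on both sides. *)
Lemma sewing_bound a b p : lo <= a -> b <= hi -> itv_partition a b p ->
  `|A a b - partition_sum A a p| <= sewing_const k * M * (phi b - phi a) `^ k.
Proof.
(* Degenerate triples have defect 0 because [A] vanishes on the diagonal; they occur when the cut
   falls at an endpoint. *)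
have delta u m v : lo <= u -> u <= m -> m <= v -> v <= hi ->
    `|A u v - A u m - A m v| <= M * (phi v - phi u) `^ k.
  move=> lu; rewrite le_eqVlt => /predU1P[<-|um].
    by rewrite A_diag subr0 subrr normr0 mulr_ge0 ?powR_ge0.
  rewrite le_eqVlt => /predU1P[<-|mv] vh.
    by rewrite A_diag subrr subr0 normr0 mulr_ge0 ?powR_ge0.
  exact: A_delta.
have k0 : 0 <= k by exact: le_trans ler01 (ltW k1).
have C0 : 0 <= sewing_const k by rewrite ltW ?sewing_const_gt0.
have [n] := ubnP (size p); elim: n a b p => // n ih a b p pn la bh hp.
have ab := itv_partition_le hp.
have fab : phi a <= phi b by exact: phi_mono.
pose P x := (phi b - phi a) / 2 <= phi x - phi a.
(* If no point reaches half of the mass then [p] is empty, since the last point of a nonempty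
   partition is [b], which does. *)
have [hasP|] := boolP (has P p); last first.
  case: (lastP p) hp pn => [|p' x] hp pn; last first.
    rewrite has_rcons negb_or => /andP[+ _].
    have -> : x = b by case: hp; rewrite last_rcons => _ /eqP.
    by rewrite /P => /negP[]; lra.
  rewrite (itv_partition_nil hp) A_diag partition_sum_nil subrr normr0.
  by move=> _; rewrite mulr_ge0 ?powR_ge0 // mulr_ge0.
case/split_find: hasP hp pn => x p1 p2 Px hP1 hp.
have [hp1x hp2] := itv_partition_split hp.
have [hp1 zx] := itv_partition_rcons hp1x.
rewrite size_cat size_rcons ltnS addSn => sz.
set z := last a p1 in hp1 zx *.
have az := itv_partition_le hp1; have xb := itv_partition_le hp2.
(* As [x] is the first point with [P], its predecessor [z] is either [a] or a point where [P]
   fails. *)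
have Pz : phi z - phi a <= (phi b - phi a) / 2.
  rewrite /z; case: (lastP p1) hP1 => [_ /=|q y]; first by rewrite subrr; lra.
  rewrite has_rcons negb_or last_rcons => /andP[+ _].
  by rewrite /P -ltNge => /ltW.
have halved u v : phi u <= phi v -> phi v - phi u <= (phi b - phi a) / 2 ->
    sewing_const k * M * (phi v - phi u) `^ k <=
    sewing_const k * (1 / 2) `^ k * (M * (phi b - phi a) `^ k).
  move=> uv uvh; rewrite -[leRHS]mulrA [X in _ <= _ * X]mulrCA [leRHS]mulrA.
  rewrite ler_wpM2l ?(mulr_ge0 C0 M0) // -powRM ?subr_ge0 //.
  by rewrite ge0_ler_powR ?nnegrE ?subr_ge0 //; lra.
have i1 := ih a z p1 (leq_ltn_trans (leq_addr _ _) sz) la _ hp1.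
have i2 := ih x b p2 (leq_ltn_trans (leq_addl _ _) sz) _ bh hp2.
have {i1}i1 := le_trans (i1 _) (halved a z _ Pz).
have {i2}i2 := le_trans (i2 _) (halved x b _ _).
(* Inserting [z] and then [x] costs two defects; the two remaining terms are the errors on [a, z]
   and [x, b], and [z, x] is kept exactly. *)
have -> : A a b - partition_sum A a (rcons p1 x ++ p2) =
  (A a b - A a z - A z b) + (A z b - A z x - A x b) +
  (A a z - partition_sum A a p1) + (A x b - partition_sum A x p2).
  rewrite partition_sum_cat -cats1 partition_sum_cat partition_sum_cons.
  rewrite partition_sum_nil addr0 last_cat /= -/z.
  by rewrite !opprD !addrA [RHS](ACl (1*8*5*10*2*7*3*4*6*9)) /= !subrK.
have d1 : `|A a b - A a z - A z b| <= M * (phi b - phi a) `^ k.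
  by apply: delta => //; lra.
have faz : phi a <= phi z by apply: phi_mono; lra.
have fzb : phi z <= phi b by apply: phi_mono; lra.
have d2 : `|A z b - A z x - A x b| <= M * (phi b - phi a) `^ k.
  apply: (le_trans (delta z x b _ _ _ _)); try lra.
  by rewrite ler_wpM2l // ge0_ler_powR ?nnegrE ?subr_ge0 //; lra.
have {}i1 := i1 _ faz; have {}i2 := i2 _ _ _; set W := M * _ in d1 d2 i1 i2 *.
rewrite -mulrA -/W -[in leRHS](sewing_constE k1).
have {}i1 := i1 ltac:(lra).
have {}i2 := i2 ltac:(lra) ltac:(apply: phi_mono; lra)
  ltac:(rewrite /P in Px; lra).
have t1 := ler_normD (A a b - A a z - A z b) (A z b - A z x - A x b).
have t2 := ler_normD (A a b - A a z - A z b + (A z b - A z x - A x b))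
  (A a z - partition_sum A a p1).
apply: le_trans (ler_normD _ _) _; lra.
Qed.

End bound.
End sewing.

(** * Comparison of sums on fine partitions *)

Section refinement.
Context {R : realType} {E : completeNormedModType R}.
Context (lo hi : R) (A : R -> R -> E) (phi : R -> R) (k C d w : R).
Hypotheses (k1 : 1 < k) (C0 : 0 <= C).
Hypothesis phi_mono :
  forall u v, lo <= u -> u <= v -> v <= hi -> phi u <= phi v.
Hypothesis A_bound : forall a b p, lo <= a -> b <= hi -> itv_partition a b p ->
  `|A a b - partition_sum A a p| <= C * (phi b - phi a) `^ k.
Hypothesis phi_modulus : forall u v, lo <= u -> u <= v -> v <= hi ->
  v - u < d -> phi v - phi u <= w.

(** On each interval of [p] the error is C W^k with W <= w the mass of the interval, hence at most C
    w^(k - 1) W, and the masses W telescope. *)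
Lemma partition_sum_refine a b p q : lo <= a -> b <= hi ->
  itv_partition a b p -> itv_partition a b q -> {subset p <= q} ->
  mesh a p < d ->
  `|partition_sum A a p - partition_sum A a q|
    <= C * w `^ (k - 1) * (phi b - phi a).
Proof.
elim: p a q => [|x p ih] a q la bh hp hq pq.
  move: hq; rewrite -(itv_partition_nil hp) => /itv_partitionxx ->.
  by rewrite !subrr normr0 mulr0.
have xq : x \in q by apply: pq; rewrite inE eqxx.
case/path.splitP: xq hq pq => q1 q2 hq pq.
have [hq1 hq2] := itv_partition_split hq.
have hp2 := itv_partition_cons hp.
have ax : a < x by case: hp => /= /andP[].
have xb := itv_partition_le hp2.
rewrite mesh_cons gt_max => /andP[xad mp].
(* The points of [p] after [x] are larger than [x], whereas those of [q1] are not. *)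
have pq2 : {subset p <= q2}.
  move=> z zp; have : z \in rcons q1 x ++ q2 by apply: pq; rewrite inE zp orbT.
  rewrite mem_cat => /orP[zq1|//].
  have xz : x < z.
    case: hp2 => + _; rewrite lt_path_sortedE => /andP[/allP + _]; exact.
  case/path.splitP: zq1 hq1 => r1 r2 /itv_partition_split[_ /itv_partition_le].
  by rewrite leNgt xz.
have := ih x q2 (le_trans la (ltW ax)) bh hp2 hq2 pq2 mp.
have := A_bound la (le_trans xb bh) hq1.
have fax : phi a <= phi x by apply: phi_mono => //;
  [exact: ltW|exact: le_trans xb bh].
have : (phi x - phi a) `^ k <= w `^ (k - 1) * (phi x - phi a).
  rewrite -mulr_powRB1 ?subr_ge0 // ?(lt_trans ltr01) // mulrC.
  rewrite ler_wpM2r ?subr_ge0 // ge0_ler_powR ?nnegrE ?subr_ge0 //.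
  - by rewrite (ltW k1).
  - by apply: le_trans (phi_modulus la (ltW ax) (le_trans xb bh) xad);
    rewrite subr_ge0.
  - exact: phi_modulus la (ltW ax) (le_trans xb bh) xad.
move=> h h1 h2.
rewrite partition_sum_cons partition_sum_cat last_rcons.
have -> : A a x + partition_sum A x p -
  (partition_sum A a (rcons q1 x) + partition_sum A x q2) =
  (A a x - partition_sum A a (rcons q1 x)) +
  (partition_sum A x p - partition_sum A x q2).
  by rewrite opprD addrACA.
apply: le_trans (ler_normD _ _) _.
have := ler_wpM2l C0 h; lra.
Qed.

Lemma partition_sum_cauchy a b p q : lo <= a -> b <= hi ->
  itv_partition a b p -> itv_partition a b q -> mesh a p < d -> mesh a q < d ->
  `|partition_sum A a p - partition_sum A a q|
    <= 2 * C * w `^ (k - 1) * (phi b - phi a).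
Proof.
move=> la bh hp hq mp mq.
have [r [hr pr qr]] := itv_partition_refine hp hq.
have := partition_sum_refine la bh hp hr pr mp.
have := partition_sum_refine la bh hq hr qr mq.
rewrite (distrC (partition_sum A a q)).
have := ler_distD (partition_sum A a r) (partition_sum A a p)
  (partition_sum A a q).
lra.
Qed.

End refinement.

(** * Power inequalities and the control *)

Section powers.
Context {R : realType}.
Implicit Types x y al th : R.

Lemma ler_powR_mul x y al : 0 <= x <= y -> al <= 1 ->
  x <= x `^ al * y `^ (1 - al).
Proof.
move=> /andP[x0 xy] al1.
rewrite -[leLHS]powRr1 // -[X in x `^ X](subrKC al 1) powRD; last first.
  by apply/implyP; rewrite subrKC oner_eq0.
rewrite ler_wpM2l ?powR_ge0 // ge0_ler_powR ?nnegrE ?subr_ge0 //.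
exact: le_trans xy.
Qed.

(** After multiplication by y^(1 - al), [ler_powR_mul] applied to [x] and to [y - x] adds up to the
    claim. *)
Lemma powR_subadditive x y al : 0 <= x <= y -> 0 <= al <= 1 ->
  y `^ al - x `^ al <= (y - x) `^ al.
Proof.
move=> /andP[x0 xy] /andP[al0 al1].
have := le_trans x0 xy; rewrite le_eqVlt => /predU1P[y0|y0].
  have -> : x = 0 by apply/le_anti; rewrite x0 y0 xy.
  by rewrite -y0 !subrr; exact: powR_ge0.
rewrite lerBlDl -(ler_pM2r (powR_gt0 (1 - al) y0)) -powRD; last first.
  by apply/implyP => _; rewrite gt_eqF.
rewrite subrKC powRr1 ?(ltW y0) // mulrDl.
have h1 := @ler_powR_mul x y al ltac:(by rewrite x0 xy) al1.
have h2 := @ler_powR_mul (y - x) y al ltac:(lra) al1.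
by rewrite -[leLHS](subrKC x) lerD.
Qed.

(** A concave power lies below its tangent at [y]. This is Young's inequality for (x / y)^al and 1
    with conjugate exponents 1 / al and 1 / (1 - al), rescaled by y^al. *)
Lemma powR_tangent x y al : 0 <= x <= y -> 0 < y -> 0 < al < 1 ->
  al * (y - x) * y `^ (al - 1) <= y `^ al - x `^ al.
Proof.
move=> /andP[x0 xy] y0 /andP[al0 al1].
have r0 : 0 <= x / y by rewrite divr_ge0 // ltW.
have p0 : 0 < al^-1 by rewrite invr_gt0.
have q0 : 0 < (1 - al)^-1 by rewrite invr_gt0 subr_gt0.
have := conjugate_powR (powR_ge0 (x / y) al) ler01 p0 q0.
rewrite !invrK subrKC => /(_ erefl).
rewrite -powRrM divff ?gt_eqF // powRr1 // powR1 mul1r mulr1 => h.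
have -> : x `^ al = (x / y) `^ al * y `^ al.
  by rewrite -powRM // ?(ltW y0) // divfK // gt_eqF.
have -> : y `^ (al - 1) = y `^ al / y.
  by rewrite powRB ?powRr1 ?(ltW y0) //; apply/implyP => _; rewrite gt_eqF.
have -> : al * (y - x) * (y `^ al / y) = al * (1 - x / y) * y `^ al.
  by field; rewrite gt_eqF.
rewrite -[X in _ <= X - _]mul1r -mulrBl ler_wpM2r ?powR_ge0 //; lra.
Qed.

(** Writing b^g c^(-r) as b^(g - r) (b / c)^r, each factor increases, the second because b / c <= l
    / x. *)
Lemma powR_ratio_le (b c l x g r : R) : 0 < b <= l -> 0 < c -> 0 < x ->
  b * x <= l * c -> 0 <= r <= g -> b `^ g * c `^ (- r) <= l `^ g * x `^ (- r).
Proof.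
move=> /andP[b0 bl] c0 x0 bx /andP[r0 rg].
have l0 := lt_le_trans b0 bl.
have split y z : 0 < y -> 0 < z ->
    y `^ g * z `^ (- r) = y `^ (g - r) * (y / z) `^ r.
  move=> y0 z0; rewrite powRM ?(ltW y0) ?invr_ge0 ?(ltW z0) //.
  rewrite mulrA -powRD ?subrK; last by apply/implyP => _; rewrite gt_eqF.
  by congr (_ * _); rewrite -powR_inv1 ?(ltW z0) // -powRrM mulN1r.
rewrite !split // ler_pM ?powR_ge0 //.
  by rewrite ge0_ler_powR ?nnegrE ?subr_ge0 // ltW.
rewrite ge0_ler_powR ?nnegrE ?divr_ge0 ?(ltW b0) ?(ltW l0) ?(ltW c0)
  ?(ltW x0) //.
by rewrite ler_pdivrMr // mulrAC ler_pdivlMr.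
Qed.

Definition control (t al x : R) : R := x `^ al - (t - x) `^ al.

Lemma control_mono t al u v : 0 <= al -> 0 <= u -> u <= v -> v <= t ->
  control t al u <= control t al v.
Proof.
move=> al0 u0 uv vt; rewrite /control lerB // ge0_ler_powR ?nnegrE; lra.
Qed.

Lemma control_modulus t al u v : 0 <= al <= 1 -> 0 <= u -> u <= v -> v <= t ->
  control t al v - control t al u <= 2 * (v - u) `^ al.
Proof.
move=> al01 u0 uv vt; rewrite /control.
have h1 := @powR_subadditive u v al ltac:(lra) al01.
have := @powR_subadditive (t - v) (t - u) al ltac:(lra) al01.
by have -> : t - u - (t - v) = v - u; [ring|lra].
Qed.

(** Each of the two powers in [control] contributes a nonnegative increment. The tangent at [v]
    bounds the first one below, the tangent at [t - u] the second. *)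
Lemma control_lower t al u v x : 0 < al < 1 -> 0 <= u -> u < v -> v <= t ->
  x = v \/ x = t - u ->
  al * (v - u) * x `^ (al - 1) <= control t al v - control t al u.
Proof.
move=> al01 u0 uv vt; rewrite /control.
have h1 : u `^ al <= v `^ al by rewrite ge0_ler_powR ?nnegrE; lra.
have h2 : (t - v) `^ al <= (t - u) `^ al by rewrite ge0_ler_powR ?nnegrE; lra.
case=> ->.
  have := @powR_tangent u v al ltac:(lra) ltac:(lra) al01; lra.
have := @powR_tangent (t - v) (t - u) al ltac:(lra) ltac:(lra) al01.
by have -> : t - u - (t - v) = v - u; [ring|lra].
Qed.

(* The exponent of the control is the one for which both sides scale alike. *)
Lemma singular_defect_le_control (t u m v g th r al : R) :
  0 < th -> 0 <= r < g -> 1 < th + g ->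
  0 <= u -> u < m -> m < v -> v <= t ->
  al = (g - r) / (th + g) ->
  (v - m) `^ g * (t - m) `^ (- r)
    * (((m - u) / (t - u)) `^ th + ((m - u) / m) `^ th)
  <= 2 * al `^ (- (th + g))
     * (control t al v - control t al u) `^ (th + g).
Proof.
move=> th0 /andP[r0 rg] thg u0 um mv vt alE.
have k0 : 0 < th + g by rewrite (lt_trans ltr01).
have al01 : 0 < al < 1.
  by rewrite alE divr_gt0 ?subr_gt0 // ltr_pdivrMr // mul1r; lra.
have alk : (al - 1) * (th + g) = - (r + th).
  by rewrite alE mulrBl divfK ?gt_eqF //; ring.
(* The lower bound of the control, raised to the power th + g, yields x^(-(r + th)) by the choice of
   [al]; this is split to match the two singular factors. *)
have key x : x = v \/ x = t - u ->
    (v - u) `^ g * x `^ (- r) * ((v - u) `^ th * x `^ (- th)) <=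
    al `^ (- (th + g)) * (control t al v - control t al u) `^ (th + g).
  move=> hx; have x0 : 0 < x by case: hx => ->; lra.
  have := control_lower al01 u0 (lt_trans um mv) vt hx.
  move/(ge0_ler_powR (ltW k0)); rewrite !nnegrE.
  have c0 : 0 <= al * (v - u) * x `^ (al - 1) by rewrite !mulr_ge0
    ?powR_ge0 //; lra.
  move=> /(_ c0 (le_trans c0 (control_lower al01 u0 (lt_trans um mv) vt hx))).
  rewrite !powRM ?powR_ge0 ?mulr_ge0 ?subr_ge0 //; try lra.
  rewrite -powRrM alk => h.
  rewrite [al `^ (- _)]powRN -(ler_pM2l (powR_gt0 (th + g)
    (proj1 (andP al01)))).
  rewrite [leRHS]mulrA divff ?mul1r ?gt_eqF ?powR_gt0 //; last by lra.
  apply: le_trans h; rewrite -[leRHS]mulrA ler_wpM2l ?powR_ge0 //.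
  rewrite mulrACA -!powRD ?(addrC g) ?opprD ?(addrC (- r)) //;
    by apply/implyP => _; apply: lt0r_neq0; lra.
have frac a c : 0 < a -> 0 < c -> (a / c) `^ th = a `^ th * c `^ (- th).
  move=> a0 c0; rewrite powRM ?invr_ge0 ?ltW //.
  by rewrite -powR_inv1 ?(ltW c0) // -powRrM mulN1r.
(* The second term is singular at both ends, through (t - m)^(-r) and m^(-th), so a single [x] below
   both [v] and [t - u] is needed. *)
pose x := Num.min v (t - u).
have xv : x <= v by rewrite ge_min lexx.
have xt : x <= t - u by rewrite ge_min lexx orbT.
have x0 : 0 < x by rewrite lt_min; lra.
have hx : x = v \/ x = t - u by rewrite /x; case: leP; [left|right].
have base y : 0 < y -> y <= t - u ->
    (v - m) `^ g * (t - m) `^ (- r) <= (v - u) `^ g * y `^ (- r).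
  move=> y0 yt; apply: powR_ratio_le; try lra; nra.
rewrite mulrDr -[leRHS]mulrA mulr_natl mulr2n lerD //.
  apply: le_trans (key (t - u) (or_intror erefl)).
  rewrite ler_pM ?mulr_ge0 ?powR_ge0 //; first by apply: base; lra.
  by rewrite frac; [|lra|lra]; apply: powR_ratio_le; try lra; nra.
apply: le_trans (key x hx).
rewrite ler_pM ?mulr_ge0 ?powR_ge0 //; first exact: base.
by rewrite frac; [|lra|lra]; apply: powR_ratio_le; try lra; nra.
Qed.

(** This rests on min(1, a / c) <= 2 a / (a + c). The new denominator stays positive when [c]
    vanishes. *)
Lemma powR_ratio_interp (a c th x M : R) : 0 <= a -> 0 <= c -> 0 < a + c ->
  0 <= th <= 1 -> 0 <= M -> x <= M -> (0 < c -> x <= M * (a / c) `^ th) ->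
  x <= 2 * M * (a / (a + c)) `^ th.
Proof.
move=> a0 c0 ac /andP[th0 th1] M0 xM xMc.
have two : 2 `^ th <= 2 :> R by rewrite ler1_powR // ler1n.
have q0 : 0 <= a / (a + c) by rewrite divr_ge0 // ltW.
have step (z : R) : 0 <= z -> z <= 2 * (a / (a + c)) ->
    M * z `^ th <= 2 * M * (a / (a + c)) `^ th.
  move=> z0 zq; rewrite [2 * M]mulrC -mulrA ler_wpM2l //.
  apply: le_trans (_ : (2 * (a / (a + c))) `^ th <= _).
    by rewrite ge0_ler_powR ?nnegrE // mulr_ge0.
  by rewrite powRM // ler_wpM2r ?powR_ge0.
have [ac'|ca] := leP a c.
  have c_gt0 : 0 < c by lra.
  apply: le_trans (xMc c_gt0) (step _ _ _); first by rewrite divr_ge0.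
  rewrite mulrA ler_pdivrMr // mulrAC ler_pdivlMr //; nra.
apply: le_trans xM _; have := step 1 ler01; rewrite powR1 mulr1; apply.
rewrite mulrA ler_pdivlMr //; lra.
Qed.

End powers.

(** * Sewing with singularities at both endpoints *)

Section singular_sewing.
Context {R : realType} {E : completeNormedModType R}.
Context (A : R -> R -> E) (t g r th M : R).
Hypotheses (th0 : 0 < th) (rg : 0 <= r < g) (thg : 1 < th + g) (M0 : 0 <= M).
Hypothesis A_diag : forall u, A u u = 0.
Hypothesis A_delta : forall u m v, 0 <= u -> u < m -> m < v -> v <= t ->
  `|A u v - A u m - A m v| <= M * ((v - m) `^ g * (t - m) `^ (- r)
    * (((m - u) / (t - u)) `^ th + ((m - u) / m) `^ th)).

Let al := (g - r) / (th + g).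

Let k0 : 0 < th + g. Proof. by rewrite (lt_trans ltr01). Qed.

Let al01 : 0 < al < 1.
Proof.
by move: rg th0 => /andP[? ?] ?; rewrite divr_gt0 ?ltr_pdivrMr ?subr_gt0 //
  mul1r; lra.
Qed.

Let al01W : 0 <= al <= 1. Proof. by case/andP: al01 => /ltW -> /ltW ->. Qed.

Let C := sewing_const (th + g) * (2 * al `^ (- (th + g)) * M).

Let C0 : 0 <= C.
Proof.
apply: mulr_ge0; first by rewrite ltW // sewing_const_gt0.
by rewrite !mulr_ge0 ?powR_ge0.
Qed.

Let bound a b p : 0 <= a -> b <= t -> itv_partition a b p ->
  `|A a b - partition_sum A a p|
    <= C * (control t al b - control t al a) `^ (th + g).
Proof.
apply: sewing_bound => //.
- by rewrite !mulr_ge0 ?powR_ge0.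
- by move=> u v; apply: control_mono; case/andP: al01W.
move=> u m v u0 um mv vt; apply: le_trans (A_delta u0 um mv vt) _.
rewrite [leRHS](_ : _ = M * (2 * al `^ (- (th + g)) *
  (control t al v - control t al u) `^ (th + g))); last by ring.
by rewrite ler_wpM2l // singular_defect_le_control.
Qed.

Lemma singular_sewing_bound a b p : 0 <= a -> b <= t -> itv_partition a b p ->
  `|A a b - partition_sum A a p|
    <= sewing_const (th + g)
       * (2 * ((g - r) / (th + g)) `^ (- (th + g)) * M) * 2 `^ (th + g)
       * (b - a) `^ (g - r).
Proof.
move=> a0 bt hp; apply: le_trans (bound a0 bt hp) _; rewrite -/al -/C -mulrA.
have ab := itv_partition_le hp.
rewrite ler_wpM2l //.
(* The control of [a, b] is at most 2 (b - a)^al, and raising this to the power th + g gives the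
   exponent g - r. *)
have -> : g - r = al * (th + g) by rewrite divfK // gt_eqF.
rewrite powRrM -powRM ?powR_ge0 // ge0_ler_powR ?nnegrE ?(ltW k0) //.
- by rewrite subr_ge0; apply: control_mono => //; case/andP: al01W.
- by rewrite mulr_ge0 ?powR_ge0.
- exact: control_modulus.
Qed.

Lemma singular_sewing_cvg : 0 <= t ->
  cvg (partition_sum A 0 p @[p --> mesh_to0 0 t]).
Proof.
move=> t0; have PF := mesh_to0_proper t0.
apply: cauchy_cvg; apply/cauchy_exP => e e0.
pose W := control t al t - control t al 0.
have W0 : 0 <= W by rewrite subr_ge0; apply: control_mono => //;
  case/andP: al01W.
have k1 : 0 < th + g - 1 by rewrite subr_gt0.
(* The Cauchy estimate is 2 C W w^(k - 1) with k = th + g. Taking w^(k - 1) = z makes it less than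
   [e]; the 1 keeps the denominator positive. *)
pose z := e / (2 * C * W + 1).
have CW : 0 < 2 * C * W + 1 by rewrite ltr_wpDl // mulr_ge0 // mulr_ge0.
have z0 : 0 < z by rewrite divr_gt0.
pose w := z `^ (th + g - 1)^-1.
have wE : w `^ (th + g - 1) = z.
  by rewrite -powRrM mulVf ?gt_eqF // powRr1 // ltW.
have w0 : 0 < w by rewrite powR_gt0.
(* By [control_modulus], the mesh [d] with 2 d^al = w ensures that intervals have mass at most
   [w]. *)
pose d := (w / 2) `^ al^-1.
have d0 : 0 < d by rewrite powR_gt0 // divr_gt0.
have dE : 2 * d `^ al = w.
  rewrite -powRrM mulVf; last by rewrite gt_eqF; case/andP: al01.
  by rewrite powRr1 ?divr_ge0 ?(ltW w0) //; field.
have modulus u v : 0 <= u -> u <= v -> v <= t -> v - u < d ->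
    control t al v - control t al u <= w.
  move=> u0 uv vt uvd; apply: le_trans (control_modulus _ u0 uv vt) _ => //.
  rewrite -dE ler_wpM2l // ge0_ler_powR ?nnegrE ?subr_ge0 ?(ltW uvd)
    ?(ltW d0) //.
  by case/andP: al01W.
have [p [hp mp]] := itv_partition_small_mesh t0 d0.
exists (partition_sum A 0 p); exists d => //= q [hq mq].
rewrite -ball_normE /=.
have mono u v : 0 <= u -> u <= v -> v <= t -> control t al u <= control t al v.
  by apply: control_mono; case/andP: al01W.
apply: le_lt_trans (partition_sum_cauchy thg C0 mono bound modulus
  (lexx 0) (lexx t) hp hq mp mq) _.
rewrite wE -/W; have : z * (2 * C * W + 1) = e by rewrite divfK // gt_eqF.
by rewrite mulrDr mulr1 => <-; rewrite mulrAC mulrC ltrDl.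
Qed.

End singular_sewing.

(** In [Y u t] the first argument is the time at which the path is frozen. The abstraction covers
    both X_t(y_u) and the difference X_t(y'_u) - X_t(y_u), the latter for continuity of the
    integral. *)
Definition increment_bound {R : realType} {E : completeNormedModType R}
    (T g th K : R) (Y : R -> R -> E) : Prop :=
  (forall u s t, 0 <= u -> u <= s -> s <= t -> t <= T ->
    `|Y u t - Y u s| <= K * (t - s) `^ g) /\
  (forall u m s t, 0 <= u -> u < m -> m <= s -> s <= t -> t <= T ->
    `|(Y u t - Y u s) - (Y m t - Y m s)|
      <= K * ((m - u) / m) `^ th * (t - s) `^ g).

(** * Integration of increments against a singular kernel *)

Section kernel.
Context {R : realType} {E : completeNormedModType R}.
Context (T g r th K c s : R) (Y : R -> R -> E) (Q : R -> E -> E).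
Hypotheses (th0 : 0 < th) (rg : 0 <= r < g) (thg : 1 < th + g).
Hypotheses (K0 : 0 <= K) (c0 : 0 <= c) (sT : s <= T).
Hypothesis hY : increment_bound T g th K Y.
Hypothesis QB : forall u x y, Q u (x - y) = Q u x - Q u y.
Hypothesis Q_bound : forall m x, 0 <= m -> m < s ->
  `|Q m x| <= c * (s - m) `^ (- r) * `|x|.
Hypothesis Q_incr : forall u m x, 0 <= u -> u < m -> m < s ->
  `|Q u x - Q m x| <= c * (s - m) `^ (- r) * ((m - u) / (s - u)) `^ th * `|x|.

Let G u v := Q u (Y u v - Y u u).

Let G_diag u : G u u = 0.
Proof. by rewrite /G QB subrr. Qed.

Let G_delta u m v : 0 <= u -> u < m -> m < v -> v <= s ->
  `|G u v - G u m - G m v| <= c * K * ((v - m) `^ g * (s - m) `^ (- r)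
    * (((m - u) / (s - u)) `^ th + ((m - u) / m) `^ th)).
Proof.
move=> u0 um mv vs; rewrite /G -QB.
have -> : Y u v - Y u u - (Y u m - Y u u) = Y u v - Y u m.
  by rewrite opprB addrA subrK.
set D := Y u v - Y u m; set D' := Y m v - Y m m.
have -> : Q u D - Q m D' = (Q u D - Q m D) + Q m (D - D').
  by rewrite (QB m D D') addrA subrK.
have ms : m < s by exact: lt_le_trans vs.
have m0 : 0 <= m by rewrite (le_trans u0) // ltW.
apply: le_trans (ler_normD _ _) _; rewrite [in leRHS]mulrDr mulrDr lerD //.
  apply: le_trans (Q_incr _ u0 um ms) _.
  have := hY.1 u m v u0 (ltW um) (ltW mv) (le_trans vs sT).
  rewrite -/D => hD.
  rewrite [leRHS](_ : _ = c * (s - m) `^ (- r) * ((m - u) / (s - u)) `^ th *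
    (K * (v - m) `^ g)); last by ring.
  by rewrite ler_wpM2l // !mulr_ge0 ?powR_ge0.
apply: le_trans (Q_bound _ m0 ms) _.
have := hY.2 u m m v u0 um (lexx m) (ltW mv) (le_trans vs sT).
rewrite -/D -/D' => hD.
rewrite [leRHS](_ : _ = c * (s - m) `^ (- r) *
  (K * ((m - u) / m) `^ th * (v - m) `^ g)); last by ring.
by rewrite ler_wpM2l // !mulr_ge0 ?powR_ge0.
Qed.

Lemma kernel_sum_cvg : 0 <= s ->
  cvg (partition_sum G 0 p @[p --> mesh_to0 0 s]).
Proof.
by apply: (singular_sewing_cvg (r := r) th0 rg thg (mulr_ge0 c0 K0)).
Qed.

(** The 1 in the constant accounts for the germ [G a b] on the whole interval, the rest for the
    sewing error. Only b <= s is required, so the bound serves both [0, s] and the final piece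
    [s, t]. *)
Lemma kernel_sum_bound a b p : 0 <= a -> b <= s -> itv_partition a b p ->
  `|partition_sum G a p|
    <= (1 + sewing_const (th + g)
            * (2 * ((g - r) / (th + g)) `^ (- (th + g))) * 2 `^ (th + g))
       * (c * K) * (b - a) `^ (g - r).
Proof.
move=> a0 bs hp.
have := singular_sewing_bound th0 rg thg (mulr_ge0 c0 K0) G_diag G_delta a0 bs
  hp.
have GAB : `|G a b| <= c * K * (b - a) `^ (g - r).
  have := itv_partition_le hp; rewrite le_eqVlt => /predU1P[<-|ab].
    by rewrite G_diag normr0 !mulr_ge0 ?powR_ge0.
  apply: le_trans (Q_bound _ a0 (lt_le_trans ab bs)) _.
  have := hY.1 a a b a0 (lexx a) (ltW ab) (le_trans bs sT) => hD.
  apply: le_trans (_ : c * (b - a) `^ (- r) * (K * (b - a) `^ g) <= _);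
    last first.
    rewrite powRD; last by apply/implyP => _; rewrite gt_eqF // subr_gt0.
    by rewrite [leRHS](_ : _ =
      c * (b - a) `^ (- r) * (K * (b - a) `^ g)) //; ring.
  rewrite ler_pM ?mulr_ge0 ?powR_ge0 // ler_wpM2l //.
  rewrite !powRN lef_pV2 ?posrE ?powR_gt0 ?subr_gt0 ?(lt_le_trans ab bs) //.
  rewrite ge0_ler_powR ?nnegrE ?subr_ge0 ?(ltW ab) ?(ltW (lt_le_trans ab bs))
    ?lerD2r //.
  by case/andP: rg.
set W := (b - a) `^ _ in GAB *; set sw := sewing_const _; set al := _ `^ (- _).
set tw := 2 `^ _ => h.
rewrite distrC in h; rewrite -[partition_sum G a p](subrK (G a b)).
apply: le_trans (ler_normD _ _) _; lra.
Qed.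

End kernel.

(** * Volterra integrals of additive increments *)

Section volterra.
Context {R : realType} {E : completeNormedModType R}.
Context (T g rho si th : R) (S : R -> {linear E -> E}).
Hypotheses (rho0 : 0 <= rho) (si0 : 0 < si) (si1 : si <= 1).
Hypothesis sig : rho + si < g.
Hypotheses (th0 : 0 < th) (th1 : th <= 1) (thg : 1 < th + g).
Hypothesis hS : singular_operator T rho S.

Let finite_npow_gt0 (x a : R) : 0 < x -> finite_npow x a.
Proof. by move=> x0; rewrite /finite_npow gt_eqF. Qed.

(* [theta = 0] controls the increments longer than the distance to the
   singularity, [theta = th] the shorter ones. *)
Lemma singular_operator_kernel : exists2 c : R, 0 < c &
  forall t : R, t <= T ->
    (forall (m : R) x, 0 <= m -> m < t ->
      `|S (t - m) x| <= c * (t - m) `^ (- rho) * `|x|)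
    /\ (forall (u m : R) x, 0 <= u -> u < m -> m < t ->
      `|S (t - u) x - S (t - m) x|
        <= c * (t - m) `^ (- rho) * ((m - u) / (t - u)) `^ th * `|x|).
Proof.
case: hS => _ [c c0 hc] hS2 _.
have [c1 c10 h1] := hS2 th ltac:(by rewrite (ltW th0) th1).
have [c2 c20 h2] := hS2 0 ltac:(by rewrite lexx ler01).
(* The constant [c] serves the first bound, and the factor 2 comes from [powR_ratio_interp] in the
   second. *)
exists (c + 2 * (c1 + c2)); first by lra.
move=> t tT; split=> [m x m0 mt|u m x u0 um mt].
  apply: le_trans (hc (t - m) x _ _) _;
    [lra|by rewrite finite_npow_gt0 ?subr_gt0|].
  rewrite ler_wpM2r // ler_wpM2r ?powR_ge0 //; lra.
have tm0 : 0 < t - m by rewrite subr_gt0.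
have mu0 : 0 < m - u by rewrite subr_gt0.
have tu0 : 0 < t - u by rewrite subr_gt0 (lt_trans um).
have c12 : 0 <= c1 + c2 by rewrite addr_ge0 // ltW.
pose P := (t - m) `^ (- rho) * `|x|.
have P0 : 0 <= P by rewrite mulr_ge0 ?powR_ge0.
have tuE : t - u = (m - u) + (t - m) by ring.
have th01 : 0 <= th <= 1 by rewrite (ltW th0) th1.
have := @powR_ratio_interp R (m - u) (t - m) th `|S (t - u) x - S (t - m) x|
  ((c1 + c2) * P) (ltW mu0) (ltW tm0).
rewrite -tuE => /(_ tu0 th01 (mulr_ge0 c12 P0)) hI.
have st : 0 <= t - m <= t - u by rewrite (ltW tm0) lerB // ltW.
have tuT : t - u <= T by rewrite (le_trans _ tT) // gerBl.
apply: le_trans (hI _ _) _.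
- have := h2 (t - m) (t - u) x st tuT (finite_npow_gt0 _ tm0).
  rewrite powRr0 mulr1 add0r -mulrA => h; apply: le_trans h _.
  by rewrite ler_wpM2r // lerDr ltW.
- move=> _.
  have := h1 (t - m) (t - u) x st tuT (finite_npow_gt0 _ tm0).
  have -> : t - u - (t - m) = m - u by ring.
  rewrite opprD powRD; last by apply/implyP => _; rewrite gt_eqF.
  move=> h; apply: le_trans h _.
  rewrite powRM ?invr_ge0 ?(ltW mu0) ?(ltW tm0) //.
  rewrite -[(t - m)^-1]powR_inv1 ?(ltW tm0) // -powRrM mulN1r.
  rewrite [leLHS](_ : _ = c1 * (P * ((m - u) `^ th * (t - m) `^ (- th))));
    last first.
    by rewrite /P; ring.
  rewrite -[leRHS]mulrA ler_wpM2r ?mulr_ge0 ?powR_ge0 //.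
  by rewrite lerDl ltW.
rewrite [leLHS](_ : _ = (2 * (c1 + c2)) * (P * ((m - u) / (t - u)) `^ th));
  last by ring.
rewrite [leRHS](_ : _ = (c + 2 * (c1 + c2)) * (P * ((m - u) / (t - u)) `^ th));
  last first.
  by rewrite /P; ring.
by rewrite ler_wpM2r ?mulr_ge0 ?powR_ge0 // lerDr ltW.
Qed.

(** Condition (ii) with theta = si and condition (iii) with theta' = si extract (t - s)^si, at the
    price of a singularity of order rho + si. The ratio again comes from interpolating theta = 0 and
    theta = th. *)
Lemma singular_operator_kernelB : exists2 c : R, 0 < c &
  forall s t : R, s <= t -> t <= T ->
    (forall (m : R) x, 0 <= m -> m < s -> `|S (t - m) x - S (s - m) x|
      <= c * (t - s) `^ si * (s - m) `^ (- (rho + si)) * `|x|)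
    /\ (forall (u m : R) x, 0 <= u -> u < m -> m < s ->
      `|(S (t - u) x - S (s - u) x) - (S (t - m) x - S (s - m) x)|
        <= c * (t - s) `^ si * (s - m) `^ (- (rho + si))
           * ((m - u) / (s - u)) `^ th * `|x|).
Proof.
case: hS => _ _ hS2 hS3.
have si01 : 0 <= si <= 1 by rewrite (ltW si0) si1.
have [c c0 hc] := hS2 si si01.
have [c1 c10 h1] := hS3 th si ltac:(by rewrite (ltW th0) th1) si01.
have [c2 c20 h2] := hS3 0 si ltac:(by rewrite lexx ler01) si01.
exists (c + 2 * (c1 + c2)); first by lra.
move=> s t st tT; split=> [m x m0 ms|u m x u0 um ms].
  have sm0 : 0 < s - m by rewrite subr_gt0.
  have st' : 0 <= s - m <= t - m by rewrite (ltW sm0) lerB.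
  have tmT : t - m <= T by rewrite (le_trans _ tT) // gerBl.
  have := hc (s - m) (t - m) x st' tmT (finite_npow_gt0 _ sm0).
  have -> : t - m - (s - m) = t - s by ring.
  rewrite (addrC si) => h; apply: le_trans h _.
  by rewrite !ler_wpM2r ?powR_ge0 // lerDl mulr_ge0 // addr_ge0 // ltW.
have sm0 : 0 < s - m by rewrite subr_gt0.
have mu0 : 0 < m - u by rewrite subr_gt0.
have su0 : 0 < s - u by rewrite subr_gt0 (lt_trans um).
have c12 : 0 <= c1 + c2 by rewrite addr_ge0 // ltW.
pose P := (t - s) `^ si * (s - m) `^ (- (rho + si)) * `|x|.
have P0 : 0 <= P by rewrite !mulr_ge0 ?powR_ge0.
have suE : s - u = (m - u) + (s - m) by ring.
have th01 : 0 <= th <= 1 by rewrite (ltW th0) th1.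
set N := `|_ - _|.
(* Condition (iii) groups the four terms by [t] and [s] rather than by [u] and [m], with the
   opposite sign. *)
have NE : N = `|(S (t - m) x - S (t - u) x) - (S (s - m) x - S (s - u) x)|.
  rewrite /N -normrN; congr `|_|.
  by rewrite !opprB !addrA [LHS](ACl (1*4*3*2)).
have := @powR_ratio_interp R (m - u) (s - m) th N
  ((c1 + c2) * P) (ltW mu0) (ltW sm0).
rewrite -suE => /(_ su0 th01 (mulr_ge0 c12 P0)) hI.
have um' : 0 <= u <= m by rewrite u0 ltW.
have ms' : m <= s <= t by rewrite st ltW.
apply: le_trans (hI _ _) _.
- have := h2 u m s t x um' ms' tT (finite_npow_gt0 _ sm0).
  rewrite -NE powRr0 mulr1 add0r (addrC si) => h; apply: le_trans h _.
  rewrite [leLHS](_ : _ = c2 * P); last by rewrite /P; ring.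
  by rewrite ler_wpM2r // lerDr ltW.
- move=> _.
  have := h1 u m s t x um' ms' tT (finite_npow_gt0 _ sm0).
  rewrite -NE -addrA opprD powRD; last by apply/implyP => _; rewrite gt_eqF.
  move=> h; apply: le_trans h _.
  rewrite powRM ?invr_ge0 ?(ltW mu0) ?(ltW sm0) //.
  rewrite -[(s - m)^-1]powR_inv1 ?(ltW sm0) // -powRrM mulN1r (addrC si).
  rewrite [leLHS](_ : _ = c1 * (P * ((m - u) `^ th * (s - m) `^ (- th))));
    last first.
    by rewrite /P; ring.
  rewrite -[leRHS]mulrA ler_wpM2r ?mulr_ge0 ?powR_ge0 //.
  by rewrite lerDl ltW.
rewrite [leLHS](_ : _ = (2 * (c1 + c2)) * (P * ((m - u) / (s - u)) `^ th));
  last by ring.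
rewrite [leRHS](_ : _ = (c + 2 * (c1 + c2)) * (P * ((m - u) / (s - u)) `^ th));
  last first.
  by rewrite /P; ring.
by rewrite ler_wpM2r ?mulr_ge0 ?powR_ge0 // lerDr ltW.
Qed.

(** For [Y u r] equal to [X r (y u)], the associated [partition_sum] from 0 is convertible to
    [volterra_sum]. *)
Definition volterra_germ (Y : R -> R -> E) t u v := S (t - u) (Y u v - Y u u).

Lemma volterra_sum_cvg (K : R) Y (t : R) :
  0 <= K -> increment_bound T g th K Y ->
  0 <= t <= T ->
  cvg (partition_sum (volterra_germ Y t) 0 p @[p --> mesh_to0 0 t]).
Proof.
move=> K0 hY /andP[t0 tT].
have [c c0 /(_ t tT)[h1 h2]] := singular_operator_kernel.
have rg : 0 <= rho < g by rewrite rho0 (le_lt_trans _ sig) // lerDl ltW.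
apply: (kernel_sum_cvg (Q := fun u => S (t - u)) th0 rg thg K0
  (ltW c0) tT hY) => //.
by move=> u x y; rewrite linearB.
Qed.

(** The exponent [th] of the integrand is independent of the exponent [si] of the integral, and the
    constant is uniform in [K] and [Y]. Continuity in the path depends on both. *)
Lemma volterra_lim_bound : 0 <= T -> exists2 C : R, 0 < C &
  forall (K : R) Y, 0 <= K -> increment_bound T g th K Y ->
  forall s t : R, 0 <= s -> s <= t -> t <= T ->
  `|lim (partition_sum (volterra_germ Y t) 0 p @[p --> mesh_to0 0 t])
    - lim (partition_sum (volterra_germ Y s) 0 p @[p --> mesh_to0 0 s])|
    <= C * K * (t - s) `^ si.
Proof.
move=> T0.
have [c c0 hc] := singular_operator_kernel.
have [d d0 hd] := singular_operator_kernelB.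
have rg : 0 <= rho < g by rewrite rho0 (le_lt_trans _ sig) // lerDl ltW.
have rg' : 0 <= rho + si < g by rewrite sig andbT addr_ge0 // ltW.
pose cst r := 1 + sewing_const (th + g)
  * (2 * ((g - r) / (th + g)) `^ (- (th + g))) * 2 `^ (th + g).
have cst0 r : 0 < cst r.
  rewrite ltr_wpDr // mulr_ge0 ?powR_ge0 //; apply: mulr_ge0.
    by rewrite ltW // sewing_const_gt0.
  by rewrite mulr_ge0 ?powR_ge0.
pose W := T `^ (g - (rho + si)).
have W0 : 0 <= W by exact: powR_ge0.
have cc0 : 0 <= cst rho * c by rewrite mulr_ge0 // ltW.
have dd0 : 0 <= cst (rho + si) * d by rewrite mulr_ge0 // ltW.
exists ((cst rho * c + cst (rho + si) * d) * W + 1).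
  by rewrite ltr_wpDl // mulr_ge0 // addr_ge0.
move=> K Y K0 hY s t s0 st tT.
have sT := le_trans st tT; have t0 := le_trans s0 st.
have := @volterra_sum_cvg K Y t K0 hY ltac:(by rewrite t0 tT).
set lt := lim _ => ct.
have := @volterra_sum_cvg K Y s K0 hY ltac:(by rewrite s0 sT).
set ls := lim _ => cs.
apply/ler_addgt0Pr => e e0.
have e20 : 0 < e / 2 by rewrite divr_gt0.
have PFs := mesh_to0_proper s0; have PFt := mesh_to0_proper t0.
have /cvgrPdist_lt/(_ _ e20)[x x0 hx] := ct.
have /cvgrPdist_lt/(_ _ e20)[y y0 hy] := cs.
have xy0 : 0 < Num.min x y by rewrite lt_min; apply/andP.
(* The partition [p] approximates the integral up to [s], and at the same time, followed by [q], the
   integral up to [t]. *)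
have [p [hp mp]] := itv_partition_small_mesh s0 xy0.
have [q [hq mq]] := itv_partition_small_mesh st xy0.
have lp : last 0 p = s by case: hp => _ /eqP.
have pq : itv_partition 0 t (p ++ q) by exact: itv_partition_cat hp hq.
move: mp mq; rewrite !lt_min => /andP[mpx mpy] /andP[mqx mqy].
have mpq : mesh 0 (p ++ q) < x by rewrite mesh_cat gt_max mpx lp mqx.
have {}hx := hx (p ++ q) (conj pq mpq).
have {}hy := hy p (conj hp mpy).
rewrite /= in hx hy.
set A := volterra_germ Y t in hx; set B := volterra_germ Y s in hy.
have [hc1 hc2] := hc t tT.
have hA := kernel_sum_bound (Q := fun u => S (t - u)) th0 rg thg K0
  (ltW c0) tT hY
  (fun u x y => linearB _ _ _) hc1 hc2 s0 (lexx t) hq.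
have [hd1 hd2] := hd s t st tT.
have dts0 : 0 <= d * (t - s) `^ si by rewrite mulr_ge0 ?powR_ge0 // ltW.
have QB u (a b : E) : S (t - u) (a - b) - S (s - u) (a - b) =
    (S (t - u) a - S (s - u) a) - (S (t - u) b - S (s - u) b).
  rewrite (linearB (S (t - u))) (linearB (S (s - u))) !opprB !addrA.
  by rewrite [LHS](ACl (1*4*3*2)).
have hB := kernel_sum_bound (Q := fun u x => S (t - u) x - S (s - u) x)
  th0 rg' thg K0 dts0 sT hY
  QB hd1 hd2 (lexx 0) (lexx s) hp.
rewrite -/(cst _) -/A in hA; rewrite -/(cst _) subr0 in hB.
have hB' : `|partition_sum A 0 p - partition_sum B 0 p| <=
   cst (rho + si) * (d * (t - s) `^ si * K) * s `^ (g - (rho + si)).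
  by rewrite -partition_sumB.
(* The sum over [s, t] has the better exponent g - rho; the excess over [si] is absorbed in a power
   of [T]. *)
have ts : (t - s) `^ (g - rho) <= (t - s) `^ si * W.
  have -> : g - rho = si + (g - (rho + si)) by ring.
  rewrite powRD; last by apply/implyP; rewrite gt_eqF // addr_gt0 ?subr_gt0.
  rewrite ler_wpM2l ?powR_ge0 // ge0_ler_powR ?nnegrE ?subr_ge0 ?(ltW sig) //.
  by rewrite (le_trans _ tT) // gerBl.
have sW : s `^ (g - (rho + si)) <= W.
  by rewrite ge0_ler_powR ?nnegrE ?subr_ge0 ?(ltW sig).
have dK0 : 0 <= d * (t - s) `^ si * K by rewrite mulr_ge0.
have cK0 : 0 <= c * K by rewrite mulr_ge0 // ltW.
have hA' : `|partition_sum A s q| <= cst rho * c * W * K * (t - s) `^ si.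
  apply: le_trans hA _.
  rewrite [leRHS](_ : _ = cst rho * (c * K) * ((t - s) `^ si * W));
    last by ring.
  by rewrite ler_wpM2l // mulr_ge0 // ltW.
have hB'' : `|partition_sum A 0 p - partition_sum B 0 p| <=
    cst (rho + si) * d * W * K * (t - s) `^ si.
  apply: le_trans hB' _.
  rewrite [leRHS](_ : _ = cst (rho + si) * (d * (t - s) `^ si * K) * W);
    last by ring.
  by rewrite ler_wpM2l // mulr_ge0 // ltW.
rewrite partition_sum_cat lp in hx.
(* Two approximation errors, the change of kernel on [0, s], and the new piece on [s, t]. *)
have -> : lt - ls = (lt - (partition_sum A 0 p + partition_sum A s q)) +
   (partition_sum A 0 p - partition_sum B 0 p) + partition_sum A s q
   - (ls - partition_sum B 0 p).
  rewrite !opprD !opprK !addrA [RHS](ACl (1*7*(8*5)*(2*4)*(3*6))) /=.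
  by rewrite subrr addr0 addNr addr0 addNr addr0.
apply: le_trans (ler_normB _ _) _.
have n1 := ler_normD (lt - (partition_sum A 0 p + partition_sum A s q) +
  (partition_sum A 0 p - partition_sum B 0 p)) (partition_sum A s q).
have n2 := ler_normD (lt - (partition_sum A 0 p + partition_sum A s q))
  (partition_sum A 0 p - partition_sum B 0 p).
have KP : 0 <= K * (t - s) `^ si by rewrite mulr_ge0 ?powR_ge0.
lra.
Qed.

End volterra.

(** * Singular Hoelder paths *)

(** Compactness of [0, M], in near-covering form: a bound that holds eventually near each point
    holds eventually on the whole segment. *)
Lemma locally_bounded_le {R : realType} (H : R -> R) (M : R) :
  [locally [bounded H z | z in [set z : R | 0 <= z]]] ->
  exists B : R, forall z, 0 <= z <= M -> H z <= B.
Proof.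
move=> H_bnd.
have /compact_near_coveringP/near_covering_withinP := @segment_compact R 0 M.
move=> /(_ R (pinfty_nbhs R) (fun i z => H z <= i) _)[x|i [_ hi]].
  rewrite /= in_itv /= => /andP[x0 _].
  have /pinfty_ex_gt0[B B0 hB] := H_bnd x x0.
  exists ([set z | 0 <= z -> `|H z| <= B], [set i | B <= i]).
    by split; [exact: hB|exact: nbhs_pinfty_ge (num_real B)].
  move=> [z i] /= [hz Bi]; rewrite in_itv /= => /andP[z0 _].
  exact: le_trans (ler_norm _) (le_trans (hz z0) Bi).
have i1 : i < i + 1 by rewrite ltrDl.
by exists (i + 1) => z zM; apply: (hi _ i1); rewrite /= in_itv.
Qed.

Section singular_paths.
Context {R : realType} {E : completeNormedModType R}.
Context (T sigma : R).
Hypotheses (T0 : 0 <= T) (sigma0 : 0 <= sigma).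
Implicit Types (y z : R -> E).

Lemma singular_holder_seminorm_le y (N : R) :
  (singular_holder_seminorm T sigma y <= N%:E)%E <->
  forall s t zeta : R, 0 <= s <= t -> t <= T -> 0 <= zeta <= sigma ->
    `|y t - y s| * s `^ zeta / (t - s) `^ zeta <= N.
Proof.
split=> [h s t zeta st tT zs|h].
  rewrite -lee_fin; apply: le_trans h; apply: ereal_sup_ubound.
  by exists s, t, zeta.
by apply: ge_ereal_sup => _ [s [t [zeta [st tT zs ->]]]]; rewrite lee_fin h.
Qed.

Lemma singular_holder_seminorm_ge0 y :
  (0 <= singular_holder_seminorm T sigma y)%E.
Proof.
apply: ereal_sup_ubound; exists 0, 0, 0.
by rewrite !lexx; split => //; rewrite subrr normr0 !mul0r.
Qed.

Lemma singular_holder_fin y : singular_holder T sigma y ->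
  exists2 N : R, 0 <= N & singular_holder_seminorm T sigma y = N%:E.
Proof.
rewrite /singular_holder => h.
have f : singular_holder_seminorm T sigma y \is a fin_num.
  by rewrite ge0_fin_numE // singular_holder_seminorm_ge0.
exists (fine (singular_holder_seminorm T sigma y)); last by rewrite fineK.
exact/fine_ge0/singular_holder_seminorm_ge0.
Qed.

Lemma seminorm_increment y (N s t : R) :
  (singular_holder_seminorm T sigma y <= N%:E)%E -> 0 <= s <= t -> t <= T ->
  `|y t - y s| <= N.
Proof.
move=> /singular_holder_seminorm_le h st tT.
have := h s t 0 st tT; rewrite lexx => /(_ sigma0).
(* With zeta = 0 both weights are 1, also at s = 0, since a zero exponent gives 1. *)
by rewrite !powRr0 mulr1 divr1.
Qed.

Lemma seminorm_sup y (N t : R) :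
  (singular_holder_seminorm T sigma y <= N%:E)%E -> 0 <= t <= T ->
  `|y t| <= `|y 0| + N.
Proof.
move=> h /andP[t0 tT].
have := @seminorm_increment y N 0 t h; rewrite lexx t0 => /(_ isT tT) h0.
have := ler_normD (y 0) (y t - y 0); rewrite subrKC => h1.
by apply: le_trans h1 _; rewrite lerD2l.
Qed.

(** Interpolation between zeta = 0 and zeta = sigma replaces the weight u^(-sigma) by m^(-sigma),
    which is harmless at u = 0. *)
Lemma seminorm_relative_increment y (N u m : R) : sigma <= 1 ->
  (singular_holder_seminorm T sigma y <= N%:E)%E -> 0 <= u -> u < m -> m <= T ->
  `|y m - y u| <= 2 * N * ((m - u) / m) `^ sigma.
Proof.
move=> sigma1 h u0 um mT.
have um' : 0 <= u <= m by rewrite u0 ltW.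
have hN := seminorm_increment h um' mT.
have mE : m = (m - u) + u by rewrite subrK.
have := @powR_ratio_interp R (m - u) u sigma `|y m - y u| N.
rewrite -mE; apply => //.
- by rewrite subr_ge0 ltW.
- exact: le_lt_trans u0 um.
- by rewrite sigma0.
- exact: le_trans (normr_ge0 _) hN.
move=> u_gt0; have := (singular_holder_seminorm_le y N).1 h u m sigma um' mT.
rewrite sigma0 lexx => /(_ isT).
have mu : 0 < (m - u) `^ sigma by rewrite powR_gt0 // subr_gt0.
rewrite ler_pdivrMr // -ler_pdivlMr ?powR_gt0 // => h'.
apply: le_trans h' _; rewrite powRM ?invr_ge0 ?subr_ge0 ?(ltW um) //.
by rewrite -[u^-1]powR_inv1 // -powRrM mulN1r powRN mulrA.
Qed.

(** An ordinary Hoelder bound suffices, since (t - s)^(sigma - zeta) s^zeta <= T^sigma. *)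
Lemma singular_holder_seminorm_bound z (B : R) : 0 <= B ->
  (forall s t, 0 <= s -> s <= t -> t <= T ->
    `|z t - z s| <= B * (t - s) `^ sigma) ->
  (singular_holder_seminorm T sigma z <= (B * T `^ sigma)%:E)%E.
Proof.
move=> B0 h; apply/singular_holder_seminorm_le.
move=> s t zeta /andP[s0 st] tT /andP[zeta0 zs].
move: (st); rewrite le_eqVlt => /predU1P[<-|st'].
  by rewrite subrr normr0 !mul0r mulr_ge0 ?powR_ge0.
have ts : 0 < t - s by rewrite subr_gt0.
rewrite ler_pdivrMr ?powR_gt0 //.
apply: le_trans (_ : B * (t - s) `^ sigma * s `^ zeta <= _).
  by rewrite ler_wpM2r ?powR_ge0 // h.
have -> : (t - s) `^ sigma = (t - s) `^ (sigma - zeta) * (t - s) `^ zeta.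
  by rewrite -powRD ?subrK //; apply/implyP => _; rewrite gt_eqF.
have -> : T `^ sigma = T `^ (sigma - zeta) * T `^ zeta.
  rewrite -powRD ?subrK //; apply/implyP => _; rewrite gt_eqF //.
  by rewrite (lt_le_trans _ tT) // (le_lt_trans s0).
rewrite [leLHS](_ : _ = B * (t - s) `^ zeta
  * ((t - s) `^ (sigma - zeta) * s `^ zeta)); last by ring.
rewrite [leRHS](_ : _ = B * (t - s) `^ zeta
  * (T `^ (sigma - zeta) * T `^ zeta)); last by ring.
rewrite ler_wpM2l ?mulr_ge0 ?powR_ge0 // ler_pM ?powR_ge0 //.
  rewrite ge0_ler_powR ?nnegrE ?subr_ge0 // ?(ltW ts) //.
  by rewrite (le_trans _ tT) // gerBl.
by rewrite ge0_ler_powR ?nnegrE // (le_trans st).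
Qed.

End singular_paths.

(** * Nonlinear increments along a path *)

Lemma subrACA {V : zmodType} (a b c d : V) : a - b - (c - d) = a - c - (b - d).
Proof. by rewrite !opprB !addrA [LHS](ACl (1*4*3*2)). Qed.

Lemma powR_geometric_mean {R : realType} (x p d e : R) :
  0 <= x -> x <= p -> x <= d -> 0 <= e <= 1 -> x <= p `^ (1 - e) * d `^ e.
Proof.
move=> x0 xp xd /andP[e0 e1].
have {1}-> : x = x `^ (1 - e) * x `^ e.
  by rewrite -powRD ?subrK ?powRr1 // oner_eq0.
by rewrite ler_pM ?powR_ge0 // ge0_ler_powR ?nnegrE ?subr_ge0 // (le_trans x0).
Qed.

Section nonlinear_young.
Context {R : realType} {E : completeNormedModType R}.
Context (T g sigma C1 C2 : R) (H : R -> R) (X : R -> E -> E).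
Hypotheses (T0 : 0 <= T) (sigma0 : 0 < sigma) (sigma1 : sigma <= 1).
Hypotheses (C10 : 0 <= C1) (C20 : 0 <= C2).
Hypothesis hX1 : forall (x : E) (s t : R), 0 <= s <= t -> t <= T ->
  `|X t x - X s x| <= C1 * H `|x| * (t - s) `^ g.
Hypothesis hX2 : forall (x y : E) (s t : R), 0 <= s <= t -> t <= T ->
  `|(X t x - X s x) - (X t y - X s y)|
    <= C2 * H (Num.max `|x| `|y|) * `|x - y| * (t - s) `^ g.

(** The larger of the two norms is one of them, so bounding [H] at both is enough. *)
Let hX2B (B : R) (x y : E) (s t : R) : H `|x| <= B -> H `|y| <= B ->
  0 <= s <= t -> t <= T ->
  `|(X t x - X s x) - (X t y - X s y)| <= C2 * B * `|x - y| * (t - s) `^ g.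
Proof.
move=> xB yB st tT; apply: le_trans (hX2 _ _ st tT) _.
rewrite ler_wpM2r ?powR_ge0 // ler_wpM2r // ler_wpM2l //.
by rewrite maxEle; case: ifP.
Qed.

Lemma path_increment_bound (B N : R) (y : R -> E) :
  0 <= B -> 0 <= N -> (forall t : R, 0 <= t <= T -> H `|y t| <= B) ->
  (singular_holder_seminorm T sigma y <= N%:E)%E ->
  increment_bound T g sigma ((C1 + 2 * C2) * (B * (1 + N)))
    (fun u t => X t (y u)).
Proof.
move=> B0 N0 hB hN; split=> [u s t u0 us st tT|u m s t u0 um ms st tT].
  have uT : 0 <= u <= T by rewrite u0 (le_trans us) // (le_trans st).
  apply: le_trans (hX1 _ _ tT) _; first by rewrite (le_trans u0).
  rewrite ler_wpM2r ?powR_ge0 //.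
  apply: le_trans (_ : C1 * (B * (1 + N)) <= _).
    by rewrite ler_wpM2l // (le_trans (hB _ uT)) // ler_peMr // lerDl.
  by rewrite ler_wpM2r ?mulr_ge0 ?addr_ge0 // lerDl mulr_ge0.
have m0 : 0 <= m by rewrite (le_trans u0) // ltW.
have mT : m <= T by rewrite (le_trans ms) // (le_trans st).
have uB : H `|y u| <= B by rewrite hB // u0 (le_trans (ltW um)).
have mB : H `|y m| <= B by rewrite hB // m0 mT.
have st' : 0 <= s <= t by rewrite st (le_trans m0).
apply: le_trans (hX2B uB mB st' tT) _.
rewrite ler_wpM2r ?powR_ge0 // distrC.
apply: le_trans (_ : C2 * B * (2 * N * ((m - u) / m) `^ sigma) <= _).
  by rewrite ler_wpM2l ?mulr_ge0 //
    (seminorm_relative_increment (ltW sigma0) sigma1 hN).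
rewrite mulrA ler_wpM2r ?powR_ge0 //.
rewrite [leLHS](_ : _ = 2 * C2 * (B * N)); last by ring.
by rewrite ler_pM ?mulr_ge0 // ?lerDr // ler_wpM2l // lerDr.
Qed.

(** The double difference is bounded once by the sup distance [d] and once by the regularity of each
    path. The geometric mean with weights e and 1 - e is small in [d] and keeps the exponent sigma
    (1 - e). *)
Lemma difference_increment_bound (B N N' d e : R) (y y' : R -> E) :
  0 <= B -> 0 <= N -> 0 <= N' -> 0 < d <= 1 -> 0 < e < 1 ->
  (forall t : R, 0 <= t <= T -> H `|y t| <= B) ->
  (forall t : R, 0 <= t <= T -> H `|y' t| <= B) ->
  (forall t : R, 0 <= t <= T -> `|y' t - y t| <= d) ->
  (singular_holder_seminorm T sigma y <= N%:E)%E ->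
  (singular_holder_seminorm T sigma y' <= N'%:E)%E ->
  increment_bound T g (sigma * (1 - e)) (C2 * B * (2 * N + 2 * N' + 2) * d `^ e)
    (fun u t => X t (y' u) - X t (y u)).
Proof.
move=> B0 N0 N'0 /andP[d0 d1] /andP[e0 e1] hB hB' hd hN hN'.
have one (u s t : R) : 0 <= u <= T -> 0 <= s <= t -> t <= T ->
    `|(X t (y' u) - X s (y' u)) - (X t (y u) - X s (y u))|
      <= C2 * B * d * (t - s) `^ g.
  move=> uT st tT; apply: le_trans (hX2B (hB' _ uT) (hB _ uT) st tT) _.
  by rewrite ler_wpM2r ?powR_ge0 // ler_wpM2l ?mulr_ge0 // hd.
have L0 : 0 <= C2 * B * (2 * N + 2 * N' + 2).
  by rewrite mulr_ge0 ?addr_ge0 ?mulr_ge0.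
split=> [u s t u0 us st tT|u m s t u0 um ms st tT].
  have uT : 0 <= u <= T by rewrite u0 (le_trans us) // (le_trans st).
  have st' : 0 <= s <= t by rewrite st (le_trans u0).
  rewrite subrACA; apply: le_trans (one _ _ _ uT st' tT) _.
  rewrite ler_wpM2r ?powR_ge0 // -[leRHS]mulrA ler_wpM2l ?mulr_ge0 //.
  apply: le_trans (_ : d `^ e <= _); first by rewrite ger1_powR ?d0 // ltW.
  rewrite ler_peMl ?powR_ge0 //.
  have : 0 <= N + N' by rewrite addr_ge0.
  lra.
have m0 : 0 <= m by rewrite (le_trans u0) // ltW.
have mT : m <= T by rewrite (le_trans ms) // (le_trans st).
have uT' : 0 <= u <= T by rewrite u0 (le_trans (ltW um)).
have mT' : 0 <= m <= T by rewrite m0 mT.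
have st' : 0 <= s <= t by rewrite st (le_trans m0).
pose W := (t - s) `^ g; have W0 : 0 <= W by exact: powR_ge0.
pose L := C2 * B * (2 * N + 2 * N' + 2); rewrite -/L in L0.
pose q := (m - u) / m.
have q0 : 0 <= q by rewrite divr_ge0 // subr_ge0 ltW.
rewrite -/L -/W -/q; set x := `|_|.
have xE : x = `|((X t (y' u) - X s (y' u)) - (X t (y u) - X s (y u))) -
  ((X t (y' m) - X s (y' m)) - (X t (y m) - X s (y m)))|.
  by rewrite /x; congr `| _ - _ |; rewrite subrACA.
(* Terms are paired at equal times [u] and [m], where the two paths are close. *)
have x1 : x <= L * W * d.
  rewrite xE; apply: le_trans (ler_normB _ _) _.
  apply: le_trans (lerD (one _ _ _ uT' st' tT) (one _ _ _ mT' st' tT)) _.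
  rewrite -/W [leLHS](_ : _ = (C2 * B * W * d) * 2); last by ring.
  rewrite [leRHS](_ : _ = (C2 * B * W * d) * (2 * N + 2 * N' + 2));
    last by rewrite /L; ring.
  by rewrite ler_wpM2l ?mulr_ge0 ?(ltW d0) // lerDr addr_ge0 ?mulr_ge0.
(* Terms are paired along each path, whose increment from [u] to [m] is controlled by its
   seminorm. *)
have x2 : x <= L * W * q `^ sigma.
  rewrite xE subrACA; apply: le_trans (ler_normB _ _) _.
  apply: le_trans (lerD (hX2B (hB' _ uT') (hB' _ mT') st' tT)
                        (hX2B (hB _ uT') (hB _ mT') st' tT)) _.
  have r1 := seminorm_relative_increment (ltW sigma0) sigma1 hN u0 um mT.
  have r2 := seminorm_relative_increment (ltW sigma0) sigma1 hN' u0 um mT.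
  rewrite -/W (distrC (y u)) (distrC (y' u)).
  apply: le_trans (_ : C2 * B * (2 * N' * q `^ sigma) * W +
                       C2 * B * (2 * N * q `^ sigma) * W <= _).
    by rewrite lerD // ler_wpM2r // ler_wpM2l ?mulr_ge0.
  rewrite [leLHS](_ : _ = (C2 * B * W * q `^ sigma) * (2 * N + 2 * N'));
    last by ring.
  rewrite [leRHS](_ : _ = (C2 * B * W * q `^ sigma) * (2 * N + 2 * N' + 2));
    last by rewrite /L; ring.
  by rewrite ler_wpM2l ?mulr_ge0 ?powR_ge0 // lerDl.
have e01 : 0 <= e <= 1 by rewrite !ltW.
apply: le_trans (powR_geometric_mean (normr_ge0 _) x2 x1 e01) _.
have LW0 : 0 <= L * W by rewrite mulr_ge0.
rewrite !(powRM _ LW0) ?powR_ge0 ?(ltW d0) // -powRrM mulrACA -powRD;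
  last first.
  by apply/implyP; rewrite subrK oner_eq0.
rewrite subrK powRr1 // [leRHS](_ : _ =
  L * W * (q `^ (sigma * (1 - e)) * d `^ e)) //.
by ring.
Qed.

End nonlinear_young.

(** * The nonlinear Young-Volterra integral *)

Section young_volterra_theory.
Context {R : realType} {E : completeNormedModType R}.
Implicit Types (X : R -> E -> E) (S : R -> {linear E -> E}) (y : R -> E).

Lemma young_volterra0 S X y : young_volterra S X y 0 = 0.
Proof.
have PF := mesh_to0_proper (lexx (0 : R)).
apply: cvg_lim => //; apply/cvgrPdist_lt => e e0.
exists 1 => //= p [/itv_partitionxx -> _].
by rewrite /volterra_sum /partition_intervals /= big_nil subrr normr0.
Qed.

(** The sum is linear in [Y] although the integral is not linear in the path. Hence
    [volterra_lim_bound] applies to a difference of two integrals. *)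
Lemma lim_volterra_germB S (Y Y' : R -> R -> E) t : 0 <= t ->
  cvg (partition_sum (volterra_germ S Y t) 0 p @[p --> mesh_to0 0 t]) ->
  cvg (partition_sum (volterra_germ S Y' t) 0 p @[p --> mesh_to0 0 t]) ->
  lim (partition_sum (volterra_germ S Y' t) 0 p @[p --> mesh_to0 0 t]) -
  lim (partition_sum (volterra_germ S Y t) 0 p @[p --> mesh_to0 0 t]) =
  lim (partition_sum (volterra_germ S (fun u r => Y' u r - Y u r) t) 0 p
         @[p --> mesh_to0 0 t]).
Proof.
move=> t0 c c'; have PF := mesh_to0_proper t0.
apply/esym/cvg_lim => //.
rewrite (_ : partition_sum _ 0 = (fun p =>
  partition_sum (volterra_germ S Y' t) 0 p - partition_sum (volterra_germ S Y t) 0 p)); first exact: cvgB c' c.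
apply/funext => p; rewrite -partition_sumB; congr partition_sum.
apply/funext => u; apply/funext => v.
by rewrite /volterra_germ subrACA (linearB (S (t - u))).
Qed.

End young_volterra_theory.

Theorem lemma10 (R : realType) (E : completeNormedModType R)
    (T gamma rho sigma : R)
    (hT : 0 < T) (hgamma : 1 / 2 < gamma) (hrho : 0 <= rho <= gamma)
    (hsigma : 0 < sigma < gamma - rho) (hsigma1 : sigma < 1)
    (hsg : 1 < sigma + gamma)
    (H : R -> R)
    (H_gt0 : forall z : R, 0 <= z -> 0 < H z)
    (H_bnd : [locally [bounded H z | z in [set z : R | 0 <= z]]])
    (X : R -> E -> E)
    (hX1 : exists2 C : R, 0 < C & forall (x : E) (s t : R),
       0 <= s <= t -> t <= T ->
       `|X t x - X s x| <= C * H `|x| * (t - s) `^ gamma)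
    (hX2 : exists2 C : R, 0 < C & forall (x y : E) (s t : R),
       0 <= s <= t -> t <= T ->
       `|(X t x - X s x) - (X t y - X s y)|
         <= C * H (Num.max `|x| `|y|) * `|x - y| * (t - s) `^ gamma)
    (S : R -> {linear E -> E})
    (hS : singular_operator T rho S) :
  let Theta := young_volterra S X in
  [/\ forall y : R -> E, singular_holder T sigma y ->
        forall t : R, 0 <= t <= T ->
        cvg (volterra_sum S X y t p @[p --> mesh_to0 0 t]),
      forall y : R -> E, singular_holder T sigma y ->
        singular_holder T sigma (Theta y),
      singular_holder_continuous T sigma Theta,
      exists2 C : R, 0 < C & forall y : R -> E, singular_holder T sigma y ->
        forall s t : R, 0 <= s <= t -> t <= T ->
        (`|Theta y t - Theta y s|%:E
          <= C%:E
             * ereal_sup [set (H z)%:E | z in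
                            [set z : R | (0 <= z)%R /\ z%:E <= path_sup_norm T y]]
             * (1 + singular_holder_seminorm T sigma y)
             * ((t - s) `^ sigma * T `^ (gamma - rho + sigma))%:E)%E
    & forall A : {linear E -> E}, continuous A ->
        forall y : R -> E, singular_holder T sigma y ->
        forall t : R, 0 <= t <= T ->
        volterra_sum (fun r u => A (S r u)) X y t p @[p --> mesh_to0 0 t]
          --> A (Theta y t) ].
Proof.
move=> Theta.
have [C1 C10 hX1'] := hX1; have [C2 C20 hX2'] := hX2.
have /andP[rho0 _] := hrho; have /andP[sigma0 sg] := hsigma.
have sig : rho + sigma < gamma by rewrite addrC -ltrBrDr.
have T0 := ltW hT; have sigma0W := ltW sigma0; have sigma1W := ltW hsigma1.
have C10W := ltW C10; have C20W := ltW C20.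
pose SupH y := ereal_sup [set (H z)%:E | z in
  [set z : R | (0 <= z)%R /\ (z%:E <= @path_sup_norm R E T y)%E]].
have norm_le (y : R -> E) (t : R) : 0 <= t <= T ->
    (`|y t|%:E <= path_sup_norm T y)%E.
  by move=> tT; apply: ereal_sup_ubound; exists t => //=; rewrite in_itv.
have SupHP (y : R -> E) : singular_holder T sigma y -> exists2 B : R, 0 < B &
    SupH y = B%:E /\ forall t : R, 0 <= t <= T -> H `|y t| <= B.
  move=> /(singular_holder_fin T0 sigma0W)[N N0 hN].
  have {}hN : (singular_holder_seminorm T sigma y <= N%:E)%E by rewrite hN.
  have [B hB] := locally_bounded_le (`|y 0| + N) H_bnd.
  have le1 : (path_sup_norm T y <= (`|y 0| + N)%:E)%E.
    apply: ge_ereal_sup => _ [t tT <-]; move: tT; rewrite /= in_itv /= => tT.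
    by rewrite lee_fin (seminorm_sup sigma0W hN).
  have le2 : (SupH y <= B%:E)%E.
    apply: ge_ereal_sup => _ [z [z0 zy] <-]; rewrite lee_fin hB // z0 /=.
    by rewrite -lee_fin (le_trans zy).
  have ub z : 0 <= z -> (z%:E <= path_sup_norm T y)%E -> ((H z)%:E <= SupH y)%E.
    by move=> z0 zy; apply: ereal_sup_ubound; exists z.
  (* The value z = 0 is always admissible, which makes the supremum positive and, with the bound
     above, finite. *)
  have ge1 : ((H 0)%:E <= SupH y)%E.
    apply: ub => //; apply: le_trans (norm_le y 0 _); first by rewrite lee_fin.
    by rewrite lexx.
  have SHfin : SupH y \is a fin_num.
    by rewrite fin_numElt (lt_le_trans (ltNyr _) ge1)
      (le_lt_trans le2 (ltry _)).
  exists (fine (SupH y)).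
    by rewrite -lte_fin fineK // (lt_le_trans _ ge1) // lte_fin H_gt0.
  split; first by rewrite fineK.
  move=> t tT; rewrite -lee_fin fineK // ub //; exact: norm_le.
have [C C0 hC] := volterra_lim_bound rho0 sigma0 sigma1W sig sigma0 sigma1W
  hsg hS T0.
have K0 (N B : R) : 0 <= N -> 0 < B -> 0 <= (C1 + 2 * C2) * (B * (1 + N)).
  move=> N0 B0; rewrite mulr_ge0 //; first by rewrite addr_ge0 ?mulr_ge0.
  by rewrite mulr_ge0 ?(ltW B0) // addr_ge0.
have Theta_bound (y : R -> E) (N B : R) : 0 <= N -> 0 < B ->
    (forall t : R, 0 <= t <= T -> H `|y t| <= B) ->
    (singular_holder_seminorm T sigma y <= N%:E)%E ->
    forall s t : R, 0 <= s -> s <= t -> t <= T ->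
    `|Theta y t - Theta y s|
      <= C * ((C1 + 2 * C2) * (B * (1 + N))) * (t - s) `^ sigma.
  move=> N0 B0 hB hN.
  have hY := path_increment_bound sigma0 sigma1W C10W C20W hX1' hX2'
    (ltW B0) N0 hB hN.
  exact: hC (K0 N B N0 B0) hY.
have cvgT (y : R -> E) : singular_holder T sigma y ->
    forall t : R, 0 <= t <= T ->
    cvg (volterra_sum S X y t p @[p --> mesh_to0 0 t]).
  move=> hy t tT; have [N N0 hN] := singular_holder_fin T0 sigma0W hy.
  have [B B0 [_ hB]] := SupHP y hy.
  have hN' : (singular_holder_seminorm T sigma y <= N%:E)%E by rewrite hN.
  have hY := path_increment_bound sigma0 sigma1W C10W C20W hX1' hX2'
    (ltW B0) N0 hB hN'.
  apply: (volterra_sum_cvg rho0 sigma0 sig sigma0 sigma1W hsg hS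
    (K0 N B N0 B0) hY tT).
split.
- exact: cvgT.
- move=> y hy; have [N N0 hN] := singular_holder_fin T0 sigma0W hy.
  have [B B0 [_ hB]] := SupHP y hy.
  have hN' : (singular_holder_seminorm T sigma y <= N%:E)%E by rewrite hN.
  have CK0 := mulr_ge0 (ltW C0) (K0 N B N0 B0).
  apply: le_lt_trans (ltry _).
  have h := Theta_bound y N B N0 B0 hB hN'.
  exact: (singular_holder_seminorm_bound T0 CK0 h).
- move=> y hy eps eps0; have [N N0 hN] := singular_holder_fin T0 sigma0W hy.
  have hN' : (singular_holder_seminorm T sigma y <= N%:E)%E by rewrite hN.
  (* The extra 1 leaves room for all paths within distance d <= 1 of [y]. *)
  have [B0 hB0] := locally_bounded_le (`|y 0| + N + 1) H_bnd.
  pose B := Num.max B0 0.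
  have B_ge0 : 0 <= B by rewrite le_max lexx orbT.
  have hB z : 0 <= z <= `|y 0| + N + 1 -> H z <= B.
    by move=> /hB0 h; rewrite le_max h.
  (* Lowering [sigma] to sigma (1 - e) loses at most half of the margin in sigma + gamma > 1. *)
  pose e := Num.min (1 / 2) ((sigma + gamma - 1) / 2).
  have e01 : 0 < e < 1.
    rewrite lt_min gt_min !divr_gt0 ?subr_gt0 //=; apply/orP; left; lra.
  have thg : 1 < sigma * (1 - e) + gamma.
    have : sigma * e <= e by rewrite ler_piMl // ltW; case/andP: e01.
    have : e <= (sigma + gamma - 1) / 2 by rewrite ge_min lexx orbT.
    lra.
  have th0 : 0 < sigma * (1 - e) by rewrite mulr_gt0 ?subr_gt0; case/andP: e01.
  have th1 : sigma * (1 - e) <= 1.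
    by rewrite mulr_ile1 ?subr_ge0 ?gerBl //; case/andP: e01 => *; rewrite ltW.
  have [D D0 hD] := volterra_lim_bound rho0 sigma0 sigma1W sig th0 th1 thg hS
    T0.
  pose L := C2 * B * (2 * N + 2 * (N + 1) + 2).
  have L0 : 0 <= L by rewrite mulr_ge0 ?mulr_ge0 // !addr_ge0 ?mulr_ge0
    ?addr_ge0.
  pose P := D * L * T `^ sigma.
  have P0 : 0 <= P by rewrite mulr_ge0 ?powR_ge0 // mulr_ge0 // ltW.
  pose r := eps / (P + 1).
  have r0 : 0 < r by rewrite divr_gt0 // ltr_wpDl.
  (* This gives d^e <= r, so that the final bound P d^e is at most P r < eps. *)
  pose d := Num.min 1 (r `^ e^-1).
  have d01 : 0 < d <= 1 by rewrite lt_min ge_min lexx ltr01 powR_gt0.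
  have [d0 d1] := andP d01; have [e0 e1] := andP e01.
  have de : d `^ e <= r.
    rewrite -[leRHS]powRr1 ?(ltW r0) // -(mulVf (lt0r_neq0 e0)) powRrM.
    by rewrite ge0_ler_powR ?nnegrE ?powR_ge0 ?(ltW d0) ?(ltW e0) //
      ge_min lexx orbT.
  exists d => // y' hy' hd.
  have z_semi : (singular_holder_seminorm T sigma (y' \- y)%R <= d%:E)%E.
    by apply: le_trans (ltW hd); rewrite leeDr // lee_fin.
  (* The norm of the difference adds its initial value to its seminorm, and so dominates the sup
     norm on [0, T]. *)
  have z_sup (t : R) : 0 <= t <= T -> `|y' t - y t| <= d.
    move=> tT; have hf : singular_holder T sigma (y' \- y)%R.
      exact: le_lt_trans z_semi (ltry _).
    have [Q Q0 hQ] := singular_holder_fin T0 sigma0W hf.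
    have hQ' :
        (singular_holder_seminorm T sigma (y' \- y)%R <= Q%:E)%E by rewrite hQ.
    apply: le_trans (seminorm_sup sigma0W hQ' tT) _.
    by move: hd; rewrite /singular_holder_norm hQ -EFinD lte_fin => /ltW.
  have y'_semi : (singular_holder_seminorm T sigma y' <= (N + 1)%:E)%E.
    apply/singular_holder_seminorm_le => s t zeta st tT zs.
    have h1 := (singular_holder_seminorm_le _ _ _ _).1 hN' s t zeta st tT zs.
    have h2 := (singular_holder_seminorm_le _ _ _ _).1 z_semi s t zeta st tT zs.
    apply: le_trans (_ : N + d <= _); last by rewrite lerD2l.
    apply: le_trans (lerD h1 h2); rewrite -!mulrDl.
    rewrite ler_wpM2r ?invr_ge0 ?powR_ge0 // ler_wpM2r ?powR_ge0 //=.
    apply: le_trans (ler_normD _ _).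
    by rewrite [X in _ <= `|_ + X|]subrACA subrKC.
  have hBy (t : R) : 0 <= t <= T -> H `|y t| <= B.
    move=> tT; apply: hB; rewrite normr_ge0 /=.
    by apply: le_trans (seminorm_sup sigma0W hN' tT) _; rewrite lerDl.
  have hBy' (t : R) : 0 <= t <= T -> H `|y' t| <= B.
    move=> tT; apply: hB; rewrite normr_ge0 /=.
    apply: le_trans (_ : `|y t| + `|y' t - y t| <= _).
      by apply: le_trans (ler_normD _ _); rewrite subrKC.
    by rewrite lerD ?(seminorm_sup sigma0W hN' tT) // (le_trans (z_sup _ tT)).
  have hY := difference_increment_bound sigma0 sigma1W C20W hX2' B_ge0 N0
    (addr_ge0 N0 ler01) d01 e01 hBy hBy' z_sup hN' y'_semi.
  have Ld0 : 0 <= L * d `^ e by rewrite mulr_ge0 ?powR_ge0.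
  have hTh (s t : R) : 0 <= s -> s <= t -> t <= T ->
      `|(Theta y' \- Theta y)%R t - (Theta y' \- Theta y)%R s|
        <= D * (L * d `^ e) * (t - s) `^ sigma.
    move=> s0 st tT; have t0 := le_trans s0 st; have sT := le_trans st tT.
    have tT' : 0 <= t <= T by rewrite t0.
    have sT' : 0 <= s <= T by rewrite s0.
    have := hD _ _ Ld0 hY s t s0 st tT.
    by rewrite -(lim_volterra_germB t0 (cvgT _ hy _ tT') (cvgT _ hy' _ tT'))
      -(lim_volterra_germB s0 (cvgT _ hy _ sT') (cvgT _ hy' _ sT')).
  have := singular_holder_seminorm_bound T0 (mulr_ge0 (ltW D0) Ld0) hTh.
  (* Both integrals vanish at time 0, so only the seminorm remains. *)
  rewrite /singular_holder_norm /= /Theta !young_volterra0 subrr normr0 add0e.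
  move=> h; apply: le_lt_trans h _; rewrite lte_fin.
  rewrite (_ : _ * _ = P * d `^ e); last by rewrite /P; ring.
  apply: le_lt_trans (ler_wpM2l P0 de) _.
  have : r * (P + 1) = eps by rewrite divfK // gt_eqF // ltr_wpDl.
  by rewrite mulrDr mulr1 mulrC => <-; rewrite ltrDl.
- pose W := T `^ (gamma - rho + sigma).
  have W0 : 0 < W by rewrite powR_gt0.
  have C12 : 0 < C1 + 2 * C2 by rewrite addr_gt0 // mulr_gt0.
  (* The constant may depend on [T], so the prescribed power of [T] is divided out; it is positive
     as T > 0. *)
  exists (C * (C1 + 2 * C2) / W); first by rewrite divr_gt0 // mulr_gt0.
  move=> y hy s t /andP[s0 st] tT.
  have [N N0 hN] := singular_holder_fin T0 sigma0W hy.
  have [B B0 [SB hB]] := SupHP y hy; rewrite -/(SupH y) SB hN.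
  have hN' : (singular_holder_seminorm T sigma y <= N%:E)%E by rewrite hN.
  rewrite -!EFinM lee_fin.
  apply: le_trans (Theta_bound y N B N0 B0 hB hN' s t s0 st tT) _.
  rewrite -/W le_eqVlt; apply/orP; left; apply/eqP.
  by field; rewrite gt_eqF.
- move=> A hA y hy t tT.
  (* Linearity moves [A] out of each finite sum, and its continuity carries the limit through. *)
  rewrite (_ : volterra_sum (fun r u => A (S r u)) X y t =
    A \o volterra_sum (fun r => S r) X y t); last first.
    by apply/funext => p; rewrite /volterra_sum /= linear_sum.
  exact: cvg_comp (cvgT y hy t tT) (hA _).
Qed.
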